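(* Let $\Bbbk$ be a field of characteristic zero, $t\in\Bbbk$, $n\in\mathbb N\cup\{\infty\}$, and let $q,r,s\in\mathcal{M}at_n(t)$. Let $C_{q,r}^s(t)\in\Bbbk$ be the coefficient of $\xi_s$ in the product $\xi_q\xi_r=\xi_q\circ\xi_r$ in $\mathbb S(n,t)$, expanded in the basis $\{\xi_s\mid s\in\mathcal{M}at_n(t)\}$. Then $$C_{q,r}^s(t)=\sum_{A\in\mathcal A_n(q,r,s)_t}V_A(t).$$
   Context: Combinatorics. $\mathbb N=\{1,2,\dots\}$ and $[1,n]=\{1,\dots,n\}$ ($[1,\infty]=\mathbb N$). $\Lambda(n)_t$ is the set of sequences $\beta=(\beta_i)_{i\in[1,n]}$ with $\beta_1\in t-\mathbb Z$, $\beta_i\in\mathbb Z_{\ge 0}$ for $i\ge 2$ (all but finitely many equal to $0$), and $\sum_i\beta_i=t$. For $\beta,\delta\in\Lambda(n)_t$, $\mathcal{M}at_n(\delta,\beta)_t$ is the set of matrices $q=(q_{i,j})_{i,j\in[1,n]}$ with $q_{1,1}\in t-\mathbb Z$, all other $q_{i,j}\in\mathbb Z_{\ge0}$, $\sum_{i,j}q_{i,j}=t$, column sums $\sum_i q_{i,j}=\beta_j$ and row sums $\sum_j q_{i,j}=\delta_i$. $\mathcal{M}at_n(t)$ is the union of these over all $\beta,\delta$. For $q,r,s\in\mathcal{M}at_n(t)$, $\mathcal A_n(q,r,s)_t$ is the finite set of arrays $A=(A_{i,j,k})_{i,j,k\in[1,n]}$ with $A_{1,1,1}\in t-\mathbb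 Z$, all other $A_{i,j,k}\in\mathbb Z_{\ge0}$, and $\sum_kA_{i,j,k}=q_{i,j}$, $\sum_iA_{i,j,k}=r_{j,k}$, $\sum_jA_{i,j,k}=s_{i,k}$ for all indices. For such $A$, $$V_A(t)=\prod_{i,k\in[1,n]}\frac{\left(\sum_{j}A_{i,j,k}\right)!}{\prod_{j}A_{i,j,k}!},$$ where the factor for $(i,k)=(1,1)$ means $\dfrac{a(a-1)\cdots(a-b+1)}{\prod_{j\ge2}A_{1,j,1}!}$ with $a=\sum_jA_{1,j,1}=s_{1,1}$ and $b=\sum_{j\ge2}A_{1,j,1}$. The category. $\mathfrak S_\infty$ is the group of all bijections of $\Omega=\mathbb N$, with the topology in which the pointwise stabilizers of finite subsets of $\Omega$ form a base of open neighborhoods of the identity. An action of an open subgroup $U$ on a set is smooth if all point stabilizers are open. A finitary $\widehat{\mathfrak S}_\infty$-set is a set with a smooth action of some open subgroup $U\subseteq\mathfrak S_\infty$ having finitely many orbits (one may shrink $U$); a finitary $\mathfrak S_\infty$-set is a smooth $\mathfrak S_\infty$-set with finitely many orbits. Let $\mathfrak S(p)$ be the pointwise stabilizer of $\{1,\dots,p\}$. For a finitary $\widehat{\mathfrak S}_\infty$-set $X$ there is a unique polynomial $p_X\in\mathbb Q[T]$ with $p_X(p)=|X^{\mathfrak S(p)}|$ for all sufficiently large integers $p$; set $\mu_t(X)=p_X(t)$. If $f:X\to\Bbbk$ is constant on the orbits of such an open subgroup, put $\int_X f(x)\,dx=\sum_c c\,\mu_t(f^{-1}(c))$, the sum being over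 the finitely many values $c$ of $f$. The category $\operatorname{Perm}(\mathfrak S_\infty;\mu_t)$ has as objects the finitary $\mathfrak S_\infty$-sets; $\operatorname{Hom}(X,Y)$ is the space of functions $Y\times X\to\Bbbk$ constant on the diagonal $\mathfrak S_\infty$-orbits; composition is $(g\circ f)(z,x)=\int_Y g(z,y)f(y,x)\,dy$. The algebra. For $\beta\in\Lambda(n)_t$ and $k\ge2$ let $\{\beta\}_k=[1+\sum_{i=2}^{k-1}\beta_i,\ \sum_{i=2}^{k}\beta_i]\subset\Omega$ and $\{\beta\}_1=\Omega\setminus\bigcup_{k\ge2}\{\beta\}_k$. $\mathfrak S_\beta\le\mathfrak S_\infty$ is the subgroup preserving each $\{\beta\}_k$, and $\mathcal X^\beta=\mathfrak S_\infty/\mathfrak S_\beta$. $\mathbb S(n,t)=\bigoplus_{\beta,\delta\in\Lambda(n)_t}\operatorname{Hom}_{\operatorname{Perm}(\mathfrak S_\infty;\mu_t)}(\mathcal X^\beta,\mathcal X^\delta)$, with product given by composition (zero if not composable). For $q\in\mathcal{M}at_n(\delta,\beta)_t$, $\xi_q\in\operatorname{Hom}(\mathcal X^\beta,\mathcal X^\delta)$ is the indicator function of the $\mathfrak S_\infty$-orbit of $(\mathfrak S_\delta,\sigma\mathfrak S_\beta)$ in $\mathcal X^\delta\times\mathcal X^\beta$, where $\sigma$ is any element with $|\{\delta\}_i\cap\sigma(\{\beta\}_j)|=q_{i,j}$ for all $(i,j)\ne(1,1)$. The $\xi_q$, $q\in\mathcal{M}at_n(t)$, form a $\Bbbk$-basis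 of $\mathbb S(n,t)$. *)

(* Defs.v *)
From HB Require Import structures.
From mathcomp Require Import all_boot all_order all_algebra.
From mathcomp Require Import boolp classical_sets functions cardinality fsbigop.

Set Implicit Arguments.
Unset Strict Implicit.
Unset Printing Implicit Defensive.

Import GRing.Theory.

Local Open Scope classical_set_scope.
Local Open Scope card_scope.
Local Open Scope ring_scope.

(* Sums [\sum_(i \in D) F i] and products [\big[*%R/1]_(i \in D) F i] over a
   classical set D are restricted to the support of F, and are 0 (resp. 1) if
   that support is infinite; wherever they range over a possibly infinite set
   below, finiteness of the support is either required or automatic. *)

(* The index set [1, n], n in N u {oo}: [Some m] is m and [None] is oo. *)
Definition in_range (n : option nat) (i : nat) : bool :=
  (0 < i)%N && (if n is Some m then (i <= m)%N else true).

Record idx (n : option nat) := Idx {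
  nat_of_idx :> nat;
  _ : in_range n nat_of_idx }.

HB.instance Definition _ n := [isSub for @nat_of_idx n].
HB.instance Definition _ n := [Countable of idx n by <:].

Lemma idx_gt0 n (i : idx n) : (0 < i)%N. Proof. by case: i => i /= /andP[]. Qed.

Notation Omega := (idx None).

Record perm := Perm {
  perm_fun :> Omega -> Omega;
  perm_inv : Omega -> Omega;
  perm_funK : cancel perm_fun perm_inv;
  perm_invK : cancel perm_inv perm_fun }.

Lemma permP (g h : perm) : g =1 h -> g = h.
Proof.
case: g h => [g g' gK g'K] [h h' hK h'K] /= /funext gh.
have gh' : g' = h' by apply/funext => x; apply: (can_inj gK); rewrite g'K gh h'K.
by subst; congr Perm; exact: Prop_irrelevance.
Qed.

HB.instance Definition _ := gen_eqMixin perm.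
HB.instance Definition _ := gen_choiceMixin perm.

Definition perm1 : perm := @Perm id id (fun=> erefl) (fun=> erefl).
Definition permV (g : perm) : perm := Perm (perm_invK g) (perm_funK g).
Definition permM (g h : perm) : perm :=
  Perm (can_comp (perm_funK g) (perm_funK h))
       (can_comp (perm_invK h) (perm_invK g)).

Lemma permMA : associative permM. Proof. by move=> *; apply: permP. Qed.
Lemma perm1M : left_id perm1 permM. Proof. by move=> *; apply: permP. Qed.
Lemma permM1 : right_id perm1 permM. Proof. by move=> *; apply: permP. Qed.
Lemma permVM : left_inverse perm1 permV permM.
Proof. by move=> g; apply: permP => x /=; rewrite perm_funK. Qed.
Lemma permMV : right_inverse perm1 permV permM.
Proof. by move=> g; apply: permP => x /=; rewrite perm_invK. Qed.

HB.instance Definition _ := isGroup.Build perm permMA perm1M permM1 permVM permMV.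

Lemma permEM (g h : perm) x : (g * h)%g x = g (h x). Proof. by []. Qed.

Definition fixer (A : set Omega) : set perm :=
  [set g | forall w, A w -> g w = w].

(* Open sets of the group topology with base {fixer A | A finite} at 1. *)
Definition perm_open (V : set perm) : Prop :=
  forall g, V g -> exists2 A : set Omega, finite_set A &
    forall h, fixer A h -> V (g * h)%g.

Definition frakS (p : nat) : set perm := fixer [set w | (w <= p)%N].

Record finitary := Finitary {
  fin_sort :> Type;
  act : perm -> fin_sort -> fin_sort;
  act1 : forall x, act 1%g x = x;
  actM : forall g h x, act (g * h)%g x = act g (act h x);
  act_smooth : forall x, perm_open [set g | act g x = x];
  act_orbits : exists2 F : set fin_sort, finite_set F &
    forall x, exists2 y, F y & exists g, x = act g y }.

Definition fixpts (X : finitary) (L : set X) (H : set perm) : set X :=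
  [set x | L x /\ forall g, H g -> act g x = x].

(* L is meant to be a subset of X stable under some open subgroup U of perm, and
   is then regarded as a set with an action of U only: since frakS p is contained
   in U for p large, its counting polynomial does not depend on U. *)
Definition is_counting_poly (X : finitary) (L : set X) (P : {poly rat}) : Prop :=
  exists N : nat, forall p : nat, (N <= p)%N ->
    exists2 m : nat, fixpts L (frakS p) #= `I_m & P.[p%:R] = m%:R.

Definition counting_poly (X : finitary) (L : set X) : {poly rat} :=
  xget 0 [set P | is_counting_poly L P].

Section Perm_category.
Context {k : fieldType} (t : k).

Definition mu (X : finitary) (L : set X) : k :=
  (map_poly ratr (counting_poly L)).[t].

(* f is meant to be constant on the orbits of some open subgroup. *)
Definition integral (X : finitary) (f : X -> k) : k :=
  \sum_(c \in range f) c * mu (f @^-1` [set c]).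

End Perm_category.

Section Hom.
Context {k : fieldType} (X Y : finitary).

Definition invariant_fun : {pred Y * X -> k^o} :=
  [pred f | `[< forall g y x, f (act g y, act g x) = f (y, x) >]].

Lemma invariant_fun_submod : GRing.submod_closed invariant_fun.
Proof.
split; first by apply/asboolP.
move=> a f f' /asboolP fP /asboolP f'P; apply/asboolP => g y x.
by rewrite /= !fctE fP f'P.
Qed.

HB.instance Definition _ :=
  GRing.isSubmodClosed.Build k (Y * X -> k^o) invariant_fun invariant_fun_submod.

Record Hom := MkHom { hom_fun :> Y * X -> k^o; _ : hom_fun \in invariant_fun }.

HB.instance Definition _ := [isSub for hom_fun].
HB.instance Definition _ := [Choice of Hom by <:].
HB.instance Definition _ := [SubChoice_isSubZmodule of Hom by <:].
HB.instance Definition _ := [SubZmodule_isSubLmodule of Hom by <:].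

Lemma homP (f : Hom) g y x : f (act g y, act g x) = f (y, x).
Proof. by case: f => f /= /asboolP. Qed.

End Hom.
Arguments Hom k X Y : clear implicits.

Section Composition.
Context {k : fieldType} (t : k).

Lemma fixer_stab (X : finitary) (x : X) :
  exists m : nat, forall g, frakS m g -> act g x = x.
Proof.
have [A finA Afix] := act_smooth (act1 x).
have [m mA] : exists m : nat, forall w, A w -> (w <= m)%N.
  have /finite_seqP[s As] := finA.
  exists (\max_(w <- s) nat_of_idx w)%N => w; rewrite As /= => ws.
  exact: leq_bigmax_seq.
exists m => g gm; have := Afix g; rewrite /= mul1g; apply=> w /mA wm.
exact: gm.
Qed.

Definition tperm_fun (a b w : Omega) : Omega :=
  if w == a then b else if w == b then a else w.

Lemma tperm_funK a b : involutive (tperm_fun a b).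
Proof.
move=> w; rewrite /tperm_fun.
have [->|wa] := eqVneq w a; first by rewrite eqxx; case: eqP => [->|].
have [->|wb] := eqVneq w b; first by rewrite eqxx.
by rewrite (negPf wa) (negPf wb).
Qed.

Definition transp a b : perm := Perm (tperm_funK a b) (tperm_funK a b).

Lemma perm_extend (h : perm) (m p : nat) :
    (forall w : Omega, (w <= m)%N -> (h w <= p)%N) -> (m <= p)%N ->
  exists u : perm, (forall w : Omega, (w <= m)%N -> u w = h w) /\
    (forall w, (u w <= p)%N = (w <= p)%N).
Proof.
elim: m => [|m IHm] hm mp.
  by exists 1%g; split=> // w; rewrite leqNgt idx_gt0.
have [|//|u [uh up]] := IHm; first by move=> w wm; apply: hm; exact: leqW.
  exact: ltnW.
pose a : Omega := @Idx None m.+1 isT.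
exists (transp (u a) (h a) * u)%g; split=> w; rewrite permEM /= /tperm_fun; last first.
  have ua : (u a <= p)%N by rewrite up.
  have ha : (h a <= p)%N by apply: hm.
  rewrite -[RHS]up; case: eqP => [->|_]; first by rewrite ua ha.
  by case: eqP => [->|_//]; rewrite ua ha.
have uI := can_inj (perm_funK u); have hI := can_inj (perm_funK h).
rewrite leq_eqVlt => /orP[/eqP wm|wm].
  by have -> : w = a; [exact: val_inj | rewrite eqxx].
have wa : (w == a) = false.
  by apply/negbTE/eqP => /(congr1 (@nat_of_idx None)) /= E; rewrite E ltnn in wm.
by rewrite (inj_eq uI) wa uh// (inj_eq hI) wa.
Qed.

Lemma perm_bound (h : perm) (m : nat) :
  exists2 M, (m <= M)%N & forall w : Omega, (w <= m)%N -> (h w <= M)%N.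
Proof.
elim: m => [|m [M mM hM]].
  by exists 0%N => // w; rewrite leqNgt idx_gt0.
pose a : Omega := @Idx None m.+1 isT.
exists (maxn M.+1 (h a)); first by rewrite leq_max ltnS mM.
move=> w; rewrite leq_eqVlt => /orP[/eqP wm|wm].
  by have -> : w = a; [exact: val_inj | rewrite leq_maxr].
by rewrite leq_max (leq_trans (hM _ wm))// leqnSn.
Qed.

Lemma counting_poly_translate_sub (X : finitary) (L : set X) (m : nat) (h : perm) P :
    (forall g, frakS m g -> forall x, L x -> L (act g x)) ->
  is_counting_poly L P -> is_counting_poly [set x | L (act h^-1%g x)] P.
Proof.
move=> LS [N NP].
have [M mM hM] := perm_bound h m.
exists (maxn N M) => p; rewrite geq_max => /andP[Np Mp].
have [c cL cP] := NP p Np; exists c => //.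
have [||u [uh up]] := @perm_extend h m p.
- by move=> w /hM /leq_trans; apply.
- exact: leq_trans mM Mp.
have vS : frakS m (u^-1 * h)%g.
  by move=> w wm; rewrite permEM -uh// -permEM mulVg.
have vS' : frakS m (h^-1 * u)%g.
  by move=> w wm; rewrite permEM uh// -permEM mulVg.
have LE x : L (act h^-1%g x) <-> L (act u^-1%g x).
  split=> Lx.
    by have := LS _ vS _ Lx; rewrite -actM -mulgA mulgV mulg1.
  by have := LS _ vS' _ Lx; rewrite -actM -mulgA mulgV mulg1.
have uS (v : perm) g : (forall w, (v w <= p)%N = (w <= p)%N) ->
    frakS p g -> frakS p (v^-1 * g * v)%g.
  by move=> vp gp w wp; rewrite !permEM gp /= ?vp ?perm_funK.
have -> : fixpts [set x | L (act h^-1%g x)] (frakS p) =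
    act u @` fixpts L (frakS p).
  apply/seteqP; split=> [x [Lx xS]|_ [x [Lx xS] <-]].
    exists (act u^-1%g x); last by rewrite -actM mulgV act1.
    split; first exact/LE.
    move=> g gS.
    have upV w : ((u^-1)%g w <= p)%N = (w <= p)%N by rewrite -up -permEM mulgV.
    have := uS _ _ upV gS; rewrite invgK => /xS E.
    by rewrite -[in RHS]E -!actM !mulgA mulVg mul1g.
  split; first by apply/LE; rewrite -actM mulVg act1.
  by move=> g gS; rewrite -{2}(xS _ (uS _ _ up gS)) -!actM !mulgA mulgV mul1g.
apply: card_eq_trans cL; apply: inj_card_eq => x y _ _ E.
by rewrite -[x]act1 -[y]act1 -(mulVg u) !actM E.
Qed.

Lemma mu_translate (X : finitary) (L : set X) (m : nat) (h : perm) :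
    (forall g, frakS m g -> forall x, L x -> L (act g x)) ->
  mu t [set x | L (act h^-1%g x)] = mu t L.
Proof.
move=> LS; rewrite /mu /counting_poly; congr (map_poly _ (xget _ _)).[_].
apply/seteqP; split=> P /=; last exact: counting_poly_translate_sub LS.
have [M _ hM] := perm_bound h m.
move=> /(@counting_poly_translate_sub _ _ M h^-1%g); rewrite invgK.
have -> : [set x | [set x | L (act h^-1%g x)] (act h x)] = L.
  by apply/funext => x /=; rewrite -actM mulVg act1.
apply=> g gM x /= Lx.
have hgS : frakS m (h^-1 * g * h)%g.
  by move=> w /hM wm; rewrite !permEM gM//= perm_funK.
by have := LS _ hgS _ Lx; rewrite -!actM -!mulgA mulgV mulg1.
Qed.

Lemma hom_comp_invariant (X Y Z : finitary) (g : Hom k Y Z) (f : Hom k X Y) :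
  (fun p : Z * X => integral t (fun y => g (p.1, y) * f (y, p.2)))
    \in @invariant_fun k X Z.
Proof.
apply/asboolP => h z x /=; rewrite /integral.
have E y : g (act h z, y) * f (y, act h x) =
    g (z, act h^-1%g y) * f (act h^-1%g y, x).
  have -> : y = act h (act h^-1%g y) by rewrite -actM mulgV act1.
  by rewrite !homP -!actM mulVg !actM act1.
have -> : range (fun y => g (act h z, y) * f (y, act h x)) =
    range (fun y => g (z, y) * f (y, x)).
  apply/seteqP; split=> _ [y _ <-]; first by exists (act h^-1%g y).
  by exists (act h y) => //; rewrite !homP.
apply: eq_fsbigr => c _; congr (_ * _).
have [mz zS] := fixer_stab z; have [mx xS] := fixer_stab x.
rewrite -[RHS](@mu_translate _ _ (maxn mz mx) h).
  by congr (mu _ _); apply/funext => y /=; rewrite E.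
move=> u uS y /= <-.
have zu : act u z = z by apply: zS => w wm; apply: uS; rewrite /= leq_max wm.
have xu : act u x = x.
  by apply: xS => w wm; apply: uS; rewrite /= leq_max wm orbT.
by rewrite -{1}zu -{1}xu !homP.
Qed.

Definition hom_comp (X Y Z : finitary) (g : Hom k Y Z) (f : Hom k X Y) : Hom k X Z :=
  MkHom (hom_comp_invariant g f).

Lemma hom_comp0r (X Y Z : finitary) (g : Hom k Y Z) : hom_comp g (0 : Hom k X Y) = 0.
Proof.
apply: val_inj; apply/funext => p /=; rewrite /integral.
under eq_fun do rewrite mulr0.
apply: fsbig1 => _ [_ _ <-]; exact: mul0r.
Qed.

Lemma hom_comp0l (X Y Z : finitary) (f : Hom k X Y) : hom_comp (0 : Hom k Y Z) f = 0.
Proof.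
apply: val_inj; apply/funext => p /=; rewrite /integral.
under eq_fun do rewrite mul0r.
apply: fsbig1 => _ [_ _ <-]; exact: mul0r.
Qed.

End Composition.

Section DirectSum.
Context {k : fieldType} {I : Type} (V : I -> lmodType k).

Record dsum := DSum {
  dcomp :> forall i, V i;
  dsumP : finite_set [set i | dcomp i != 0] }.

HB.instance Definition _ := gen_eqMixin dsum.
HB.instance Definition _ := gen_choiceMixin dsum.

Lemma dsum_eqP (f g : dsum) : (forall i, f i = g i) -> f = g.
Proof.
case: f g => [f fP] [g gP] /= E.
have fg : f = g by exact: functional_extensionality_dep.
by subst g; congr DSum; exact: Prop_irrelevance.
Qed.

Lemma dsum0_subproof : finite_set [set i | (0 : V i) != 0].
Proof. by apply: sub_finite_set (finite_set0 I) => i /=; rewrite eqxx. Qed.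
Definition dsum0 := DSum dsum0_subproof.

Lemma dsumN_subproof (f : dsum) : finite_set [set i | - f i != 0].
Proof. by apply: sub_finite_set (dsumP f) => i /=; rewrite oppr_eq0. Qed.
Definition dsumN f := DSum (dsumN_subproof f).

Lemma dsumD_subproof (f g : dsum) : finite_set [set i | f i + g i != 0].
Proof.
have : finite_set ([set i | f i != 0] `|` [set i | g i != 0]).
  by rewrite finite_setU; split; exact: dsumP.
apply: sub_finite_set => i /= fg; apply/orP; rewrite -negb_and.
by apply: contra fg => /andP[/eqP-> /eqP->]; rewrite addr0.
Qed.
Definition dsumD f g := DSum (dsumD_subproof f g).

Lemma dsumZ_subproof (a : k) (f : dsum) : finite_set [set i | a *: f i != 0].
Proof.
apply: sub_finite_set (dsumP f) => i /=; apply: contra => /eqP ->.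
by rewrite scaler0.
Qed.
Definition dsumZ a f := DSum (dsumZ_subproof a f).

Lemma dsumDA : associative dsumD.
Proof. by move=> f g h; apply: dsum_eqP => i; exact: addrA. Qed.
Lemma dsumDC : commutative dsumD.
Proof. by move=> f g; apply: dsum_eqP => i; exact: addrC. Qed.
Lemma dsum0D : left_id dsum0 dsumD.
Proof. by move=> f; apply: dsum_eqP => i; exact: add0r. Qed.
Lemma dsumND : left_inverse dsum0 dsumN dsumD.
Proof. by move=> f; apply: dsum_eqP => i; exact: addNr. Qed.

HB.instance Definition _ := GRing.isZmodule.Build dsum dsumDA dsumDC dsum0D dsumND.

Lemma dsumZA a b (f : dsum) : dsumZ a (dsumZ b f) = dsumZ (a * b) f.
Proof. by apply: dsum_eqP => i; exact: scalerA. Qed.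
Lemma dsum1Z : left_id 1 dsumZ.
Proof. by move=> f; apply: dsum_eqP => i; exact: scale1r. Qed.
Lemma dsumZDr : right_distributive dsumZ +%R.
Proof. by move=> a f g; apply: dsum_eqP => i; exact: scalerDr. Qed.
Lemma dsumZDl f : {morph dsumZ^~ f : a b / a + b}.
Proof. by move=> a b; apply: dsum_eqP => i; exact: scalerDl. Qed.

HB.instance Definition _ :=
  GRing.Zmodule_isLmodule.Build k dsum dsumZA dsum1Z dsumZDr dsumZDl.

End DirectSum.

Section Cosets.
Variable H : set perm.
Hypotheses (HM : forall g h, H g -> H h -> H (g * h)%g)
  (HV : forall g, H g -> H g^-1%g)
  (Hopen : exists2 A : set Omega, finite_set A & fixer A `<=` H).

Definition lcoset (g : perm) (C : set perm) : set perm :=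
  (fun h => g * h)%g @` C.

Definition cosets : set (set perm) := range (fun g => lcoset g H).

Lemma lcosetM g h C : lcoset (g * h)%g C = lcoset g (lcoset h C).
Proof.
apply/seteqP; split=> [_ [x Cx <-]|_ [_ [x Cx <-] <-]].
  by exists (h * x)%g; [exists x | rewrite mulgA].
by exists x => //; rewrite mulgA.
Qed.

Lemma lcoset1 C : lcoset 1%g C = C.
Proof.
apply/seteqP; split=> [_ [x Cx <-]|x Cx]; first by rewrite mul1g.
by exists x => //; rewrite mul1g.
Qed.

Lemma lcoset_id g : H g -> lcoset g H = H.
Proof.
move=> Hg; apply/seteqP; split=> [_ [x Hx <-]|x Hx]; first exact: HM.
by exists (g^-1 * x)%g; [exact: HM (HV Hg) Hx | rewrite mulVKg].
Qed.

Lemma coset_subproof g : lcoset g H \in cosets.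
Proof. by rewrite inE; exists g. Qed.
Definition coset_of_perm (g : perm) : cosets :=
  exist (fun C => C \in cosets) _ (coset_subproof g).

Lemma coset_act_subproof g (C : cosets) : lcoset g (val C) \in cosets.
Proof.
by have := valP C; rewrite !inE => -[x _ <-]; exists (g * x)%g => //; rewrite lcosetM.
Qed.
Definition coset_act g (C : cosets) : cosets :=
  exist (fun C => C \in cosets) _ (coset_act_subproof g C).

Lemma coset_act1 C : coset_act 1%g C = C.
Proof. by apply: val_inj; rewrite /= lcoset1. Qed.

Lemma coset_actM g h C : coset_act (g * h)%g C = coset_act g (coset_act h C).
Proof. by apply: val_inj; rewrite /= lcosetM. Qed.

Lemma coset_act_smooth C : perm_open [set g | coset_act g C = C].
Proof.
have [A finA AH] := Hopen.
have := valP C; rewrite inE => -[x _ xC] g /= gC.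
exists (x @` A); first exact: finite_image.
move=> h hA; rewrite coset_actM -[RHS]gC; congr coset_act.
apply: val_inj; rewrite /= -xC -lcosetM.
have -> : (h * x = x * (x^-1 * h * x))%g by rewrite !mulgA mulgV mul1g.
rewrite lcosetM lcoset_id//; apply: AH => w Aw.
by rewrite !permEM hA /= ?perm_funK//; exists w.
Qed.

Lemma coset_act_orbits : exists2 F : set cosets, finite_set F &
  forall C, exists2 D, F D & exists g, C = coset_act g D.
Proof.
exists [set coset_of_perm 1%g]; first exact: finite_set1.
move=> C; exists (coset_of_perm 1%g) => //.
have := valP C; rewrite inE => -[x _ xC]; exists x.
by apply: val_inj; rewrite /= lcoset1 xC.
Qed.

Definition coset_space : finitary :=
  Finitary coset_act1 coset_actM coset_act_smooth coset_act_orbits.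

End Cosets.

Section Schur_algebra.
Context {k : fieldType}.

(* The natural number with image x in k (0 if there is none); it is unique when
   k has characteristic zero. *)
Definition natval (x : k) : nat :=
  if pselect (exists m : nat, x == m%:R) is left ex then ex_minn ex else 0%N.

Definition in_nat (x : k) : Prop := exists m : nat, x = m%:R.
Definition in_tZ (t x : k) : Prop := exists z : int, x = t - z%:~R.

Variable n : option nat.
Local Notation I := (idx n).

Definition Lam (t : k) : set (I -> k) :=
  [set b : I -> k |
    [/\ forall i : I, if i == 1%N :> nat then in_tZ t (b i) else in_nat (b i),
        finite_set [set i | b i != 0]
      & \sum_(i \in [set: I]) b i = t]].

Definition Mat (t : k) (d b : I -> k) : set (I -> I -> k) :=
  [set q : I -> I -> k |
    [/\ forall i j : I, if (i == 1%N :> nat) && (j == 1%N :> nat)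
                        then in_tZ t (q i j) else in_nat (q i j),
        finite_set [set p : I * I | q p.1 p.2 != 0],
        \sum_(p \in [set: I * I]) q p.1 p.2 = t,
        forall j, \sum_(i \in [set: I]) q i j = b j
      & forall i, \sum_(j \in [set: I]) q i j = d i]].

Definition Matn (t : k) : set (I -> I -> k) :=
  [set q | exists d b, [/\ Lam t d, Lam t b & Mat t d b q]].

(* The finite support condition is what gives a meaning to the sums of natural
   numbers when n = oo; it is implied by that of q, r and s. *)
Definition Arr (t : k) (q r s : I -> I -> k) : set (I -> I -> I -> k) :=
  [set A : I -> I -> I -> k |
    [/\ forall i j l : I, if [&& i == 1%N :> nat, j == 1%N :> nat & l == 1%N :> nat]
                      then in_tZ t (A i j l) else in_nat (A i j l),
        finite_set [set p : I * I * I | A p.1.1 p.1.2 p.2 != 0],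
        forall i j, \sum_(l \in [set: I]) A i j l = q i j,
        forall j l, \sum_(i \in [set: I]) A i j l = r j l
      & forall i l, \sum_(j \in [set: I]) A i j l = s i l]].

Definition Vfactor (A : I -> I -> I -> k) (i l : I) : k :=
  let a := \sum_(j \in [set: I]) A i j l in
  if (i == 1%N :> nat) && (l == 1%N :> nat) then
    let b := natval (\sum_(j \in [set j : I | (2 <= j)%N]) A i j l) in
    (\prod_(m < b) (a - m%:R)) /
    (\big[*%R/1]_(j \in [set j : I | (2 <= j)%N]) ((natval (A i j l))`!%:R : k))
  else
    (natval a)`!%:R / (\big[*%R/1]_(j \in [set: I]) ((natval (A i j l))`!%:R : k)).

Definition V_ (A : I -> I -> I -> k) : k :=
  \big[*%R/1]_(p \in [set: I * I]) Vfactor A p.1 p.2.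

Section Young_subgroup.
Variable b : I -> k.

Definition psum (m : nat) : nat :=
  (\sum_(i \in [set i : I | (2 <= i <= m)%N]) natval (b i))%R.

Definition interval_block (j : I) : set Omega :=
  [set w | (1 + psum j.-1 <= w <= psum j)%N].

Definition block (j : I) : set Omega :=
  if j == 1%N :> nat
  then ~` (\bigcup_(l in [set l : I | (2 <= l)%N]) interval_block l)
  else interval_block j.

Definition Young : set perm := [set g | forall j, g @` block j = block j].

Lemma YoungM g h : Young g -> Young h -> Young (g * h)%g.
Proof. by move=> Yg Yh j; rewrite -[RHS]Yg -[in RHS]Yh image_comp. Qed.

Lemma YoungV g : Young g -> Young g^-1%g.
Proof.
move=> Yg j; rewrite -[in LHS]Yg image_comp -[RHS]image_id.
by apply: eq_imagel => w _ /=; rewrite perm_funK.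
Qed.

Lemma natval0 : natval (0 : k) = 0%N.
Proof.
rewrite /natval; case: pselect => // ex; case: ex_minnP => m _ /(_ 0%N).
by rewrite eqxx => /(_ isT); rewrite leqn0 => /eqP.
Qed.

Lemma interval_block0 (j : I) : (2 <= j)%N -> b j = 0 -> interval_block j = set0.
Proof.
move=> j2 bj; rewrite /interval_block.
suff -> : psum j = psum j.-1.
  by apply/seteqP; split=> // w /= /andP[lt le]; have := leq_trans lt le; rewrite ltnn.
rewrite /psum; symmetry; apply: fsbig_widen.
  by move=> i /= /andP[-> ij]; exact: leq_trans ij (leq_pred _).
move=> i /= [/andP[i2 ij] /negP]; rewrite i2 /= -ltnNge => ji.
have -> : i = j; last by rewrite bj natval0.
apply: val_inj; apply/eqP; rewrite eqn_leq ij /=.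
by move: ji; rewrite prednK// (leq_trans _ j2).
Qed.

Lemma finite_le (p : nat) : finite_set [set w : Omega | (w <= p)%N].
Proof.
apply/finite_set_leP; exists p.+1.
apply: (@card_ge_preimage _ _ `I_p.+1 (@nat_of_idx None)) => w w' _ _ /=.
exact: val_inj.
Qed.

Lemma finite_interval_block j : finite_set (interval_block j).
Proof. by apply: sub_finite_set (finite_le (psum j)) => w /= /andP[]. Qed.

Lemma Young_open : finite_set [set i | b i != 0] ->
  exists2 A : set Omega, finite_set A & fixer A `<=` Young.
Proof.
move=> finb.
pose A := \bigcup_(l in [set l : I | (2 <= l)%N]) interval_block l.
have finA : finite_set A.
  have -> : A = \bigcup_(l in [set l : I | (2 <= l)%N /\ b l != 0]) interval_block l.
    apply/seteqP; split=> w [l /=]; last by move=> [l2 _] ?; exists l.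
    move=> l2 wl; exists l => //; split=> //; apply/eqP => bl.
    by move: wl; rewrite interval_block0.
  apply: bigcup_finite => [|l _]; last exact: finite_interval_block.
  by apply: sub_finite_set finb => l [].
exists A => // g gA; have gAV w : A w -> g^-1%g w = w.
  by move=> Aw; rewrite -[in LHS](gA _ Aw) /= perm_funK.
move=> j; rewrite /block; case: ifPn => [_|j1].
  apply/seteqP; split=> [_ [w nAw <-]|w nAw].
    move=> Agw; apply: nAw; suff -> : w = g w by [].
    by rewrite -[LHS](perm_funK g w); exact: gAV.
  exists (g^-1%g w); last by rewrite /= perm_invK.
  move=> Agw; apply: nAw; suff -> : w = g^-1%g w by [].
  by rewrite -[LHS](perm_invK g w); exact: gA.
have jA : interval_block j `<=` A.
  by move=> w wj; exists j => //=; rewrite ltn_neqAle eq_sym j1 idx_gt0.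
apply/seteqP; split=> [_ [w wj <-]|w wj]; first by rewrite gA//; exact: jA.
by exists w => //; rewrite gA//; exact: jA.
Qed.

End Young_subgroup.

Section Schur.
Variable t : k.

Lemma Lam_open (b : Lam t) :
  exists2 A : set Omega, finite_set A & fixer A `<=` Young (val b).
Proof. by apply: Young_open; have := valP b; rewrite inE => -[]. Qed.

Definition X_ (b : Lam t) : finitary :=
  coset_space (@YoungM (val b)) (@YoungV (val b)) (Lam_open b).

Definition schur : lmodType k :=
  dsum (fun p : Lam t * Lam t => Hom k (X_ p.1) (X_ p.2)).

Definition hom_at (F : schur) (b d : Lam t) : Hom k (X_ b) (X_ d) := F (b, d).

Lemma schur_mul_subproof (F G : schur) :
  finite_set [set p : Lam t * Lam t |
    \sum_(c \in [set: Lam t]) hom_comp t (hom_at F c p.2) (hom_at G p.1 c) != 0].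
Proof.
have finFG := finite_setX (finite_image fst (dsumP G)) (finite_image snd (dsumP F)).
apply: sub_finite_set finFG => -[b d] /= bd; apply: contrapT => nbd.
move/eqP: bd; apply; apply: fsbig1 => c _.
have [F0|F0] := eqVneq (hom_at F c d) 0; first by rewrite F0 hom_comp0l.
have [G0|G0] := eqVneq (hom_at G b c) 0; first by rewrite G0 hom_comp0r.
by case: nbd; split; [exists (b, c) | exists (c, d)].
Qed.

Definition schur_mul (F G : schur) : schur := DSum (schur_mul_subproof F G).

Definition rel_position (d b : I -> k) (q : I -> I -> k) (sigma : perm) : Prop :=
  forall i j : I, ~~ ((i == 1%N :> nat) && (j == 1%N :> nat)) ->
    exists2 m : nat, (block d i `&` sigma @` block b j) #= `I_m & q i j = m%:R.

(* The indicator function of the orbit of (Young d, sigma Young b); all sigma in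
   position q relative to (d, b) give the same orbit. *)
Definition xi_fun (b d : Lam t) (q : I -> I -> k) : X_ d * X_ b -> k^o :=
  let sigma := xget 1%g [set s | rel_position (val d) (val b) q s] in
  fun p => `[< exists g : perm,
    p = (act g (coset_of_perm (Young (val d)) 1%g : X_ d),
         act g (coset_of_perm (Young (val b)) sigma : X_ b)) >]%:R.

Lemma xi_fun_invariant (b d : Lam t) q : @xi_fun b d q \in @invariant_fun k _ _.
Proof.
apply/asboolP => g y x; rewrite /xi_fun; congr (nat_of_bool _)%:R.
apply: asbool_equiv_eq; split=> -[h].
  move=> /pair_equal_spec[yE xE]; exists (g^-1 * h)%g.
  by rewrite !actM -yE -xE -!actM mulVg !act1.
by move=> /pair_equal_spec[-> ->]; exists (g * h)%g; rewrite !actM.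
Qed.

Definition xi_hom (b d : Lam t) (q : I -> I -> k) : Hom k (X_ b) (X_ d) :=
  MkHom (xi_fun_invariant b d q).

Lemma xi_subproof (q : I -> I -> k) :
  finite_set [set p : Lam t * Lam t |
    (if `[< Mat t (val p.2) (val p.1) q >] then xi_hom p.1 p.2 q else 0) != 0].
Proof.
have [[p pP]|nP] := pselect (exists p : Lam t * Lam t, Mat t (val p.2) (val p.1) q).
  apply: sub_finite_set (finite_set1 p) => p' /=.
  case: asboolP => [[_ _ _ c' r'] _|_]; last by rewrite eqxx.
  have [_ _ _ c r] := pP.
  suff [E1 E2] : p'.1 = p.1 /\ p'.2 = p.2.
    by rewrite (surjective_pairing p') E1 E2 -surjective_pairing.
  split; apply: val_inj; apply/funext => i.
    by rewrite -[LHS]c' -[RHS]c.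
  by rewrite -[LHS]r' -[RHS]r.
apply: sub_finite_set (finite_set0 _) => p /=.
by case: asboolP => [pP|_]; [case: nP; exists p | rewrite eqxx].
Qed.

(* xi_q, extended by zero outside the summand Hom (X_ b) (X_ d) to which it
   belongs, b and d being the column and row sums of q. *)
Definition xi (q : Matn t) : schur := DSum (xi_subproof (val q)).

(* The coefficient of xi s in the expansion of F in the basis (xi s)_s. *)
Definition xi_coord (F : schur) : Matn t -> k :=
  xget (fun=> 0) [set c : Matn t -> k | finite_set [set s | c s != 0] /\
    F = \sum_(s \in [set: Matn t]) c s *: xi s].

End Schur.

End Schur_algebra.

Arguments Lam {k} n t _.
Arguments Matn {k} n t _.

(* Main.v *)
Require Import Defs.
From HB Require Import structures.
From mathcomp Require Import all_boot all_order all_algebra finmap ring.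
From mathcomp Require Import boolp classical_sets functions cardinality fsbigop.

(** A point of [X_ b] is a coloring of Omega by the blocks in which color [j] has
    size [b j]. Counting the color 1, which is cofinite, as if Omega had [t]
    elements, every finitely supported coloring gets a k-valued profile; two
    colorings with the same profile differ by a permutation, so the orbits on
    [X_ d * X_ b] are the profiles of the pair colorings, that is, the matrices,
    and [xi q] is the indicator of profile [q]. Hence the coefficient of [xi s] in
    [xi q * xi r] is the value at a pair (y, x) of profile [s], namely the measure
    of the set of points z such that (y, z) and (z, x) have profiles [q] and [r].
    The points of this set fixed by [frakS p] are the colorings of [1, p];
    sorting them by the profile [A] of the triple (y, z, x), each [A] contributes a
    product of multinomial coefficients, one for each cell (i, l) of (y, x). Only
    the cell (1, 1) depends on [p]: it has [p - N0] elements with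
    [s 1 1 = t - N0], so that setting p = t gives the generalized binomial factor
    of [V_ A]. *)

Set Implicit Arguments.
Unset Strict Implicit.
Unset Printing Implicit Defensive.

Import GRing.Theory.

Local Open Scope classical_set_scope.
Local Open Scope card_scope.
Local Open Scope ring_scope.

(** * Rational numbers in a field of characteristic zero *)

(** [ratr] is computed from the reduced fraction, and [a / b] need not be reduced.
    Cross-multiplication leaves an identity between integers, which is checked in [rat]. *)
Lemma ratr_frac (k : fieldType) (a b : int) : [pchar k] =i pred0 -> b != 0 ->
  ratr (a%:~R / b%:~R) = a%:~R / b%:~R :> k.
Proof.
move=> /pcharf0P k0 b0.
have intk0 (z : int) : z != 0 -> z%:~R != 0 :> k.
  by case: z => m; rewrite ?NegzE ?mulrNz ?oppr_eq0 -?pmulrn k0.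
have dn0 : (denq (a%:~R / b%:~R))%:~R != 0 :> k by apply/intk0/denq_neq0.
apply/eqP; rewrite /ratr eqr_div ?intk0// -!intrM; apply/eqP; congr _%:~R.
apply: (@intr_inj rat); rewrite !intrM numqE mulrAC divfK//.
by rewrite intr_eq0.
Qed.

Section RatMorphism.
Variables (k : fieldType) (k0 : [pchar k] =i pred0).

(* The library only makes [ratr] a ring morphism into a numFieldType; the unused
   argument lets the morphism structure below depend on the characteristic. *)
Definition char0_ratr of [pchar k] =i pred0 : rat -> k := ratr.

Lemma char0_ratr_zmod : zmod_morphism (char0_ratr k0).
Proof.
move=> x y; rewrite /char0_ratr.
rewrite -[x]divq_num_den -[y]divq_num_den -mulNr -intrN addf_div ?intr_eq0 ?denq_eq0//.
rewrite -!intrM -intrD !ratr_frac ?mulf_neq0 ?denq_neq0//.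
have d0 z : (denq z)%:~R != 0 :> k.
  by rewrite -absz_denq -pmulrn; have /pcharf0P -> := k0; rewrite absz_eq0 denq_eq0.
by rewrite -mulNr -intrN addf_div// -!intrM -intrD.
Qed.

Lemma char0_ratr_monoid : monoid_morphism (char0_ratr k0).
Proof.
rewrite /char0_ratr; split=> [|x y]; first exact: ratr_nat 1%N.
rewrite -[x]divq_num_den -[y]divq_num_den mulf_div -!intrM.
by rewrite !ratr_frac ?mulf_neq0 ?denq_neq0// !intrM mulf_div.
Qed.

HB.instance Definition _ :=
  GRing.isZmodMorphism.Build rat k (char0_ratr k0) char0_ratr_zmod.
HB.instance Definition _ :=
  GRing.isMonoidMorphism.Build rat k (char0_ratr k0) char0_ratr_monoid.

Lemma natr_inj_char0 : injective (fun m : nat => m%:R : k).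
Proof.
move=> m m'; wlog le : m m' / (m <= m')%N.
  by move=> W; have [/W|/ltnW/W H E] := leqP m m'; [apply | rewrite H].
move=> /eqP; rewrite -(subnK le) natrD eq_sym -subr_eq0 addrK.
by have /pcharf0P -> := k0 => /eqP ->.
Qed.

Lemma natval_nat (m : nat) : natval (m%:R : k) = m.
Proof.
rewrite /natval; case: pselect => [ex|[]]; last by exists m.
by case: ex_minnP => m' /eqP/natr_inj_char0.
Qed.

Lemma natvalK (x : k) : in_nat x -> (natval x)%:R = x.
Proof. by case=> m ->; rewrite natval_nat. Qed.

Lemma in_nat_sumE (T : Type) (l : seq T) (F : T -> k) :
  (forall x, in_nat (F x)) ->
  \sum_(x <- l) F x = (\sum_(x <- l) natval (F x))%N%:R.
Proof. by move=> Fn; rewrite natr_sum; apply: eq_bigr => x _; rewrite natvalK. Qed.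

End RatMorphism.

(** * Finite cardinals and finitely supported sums *)

Lemma card_set_seq (T : choiceType) (s : seq T) : uniq s -> [set` s] #= `I_(size s).
Proof.
move=> us; have -> : [set` s] = [set` seq_fset tt s].
  by apply/seteqP; split=> x; rewrite /= (seq_fsetE tt).
by apply/card_eq_fsetP; rewrite size_seq_fset undup_id.
Qed.

Lemma fsum_seq (R : nmodType) (T : choiceType) (s : seq T) (F : T -> R) :
    uniq s -> (forall x, x \notin s -> F x = 0) ->
  \sum_(x \in [set: T]) F x = \sum_(x <- s) F x.
Proof.
move=> us F0; rewrite (fsbigE s)//; last by move=> x _; exact: F0.
by apply: eq_bigl => x; rewrite in_setT.
Qed.

Lemma fsum_set1 (R : nmodType) (T : choiceType) (x0 : T) (F : T -> R) :
  (forall x, x != x0 -> F x = 0) -> \sum_(x \in [set: T]) F x = F x0.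
Proof.
move=> F0; rewrite (@fsum_seq _ _ [:: x0]) ?big_seq1// => x.
by rewrite inE => /F0.
Qed.

(** * Colorings of Omega as finite sequences *)

(** The shift matches positions in a sequence, which start at 0, with points of Omega, which start
    at 1. *)
Definition om (i : nat) : Omega := @Idx None i.+1 isT.

Lemma om_pred (w : Omega) : om (w : nat).-1 = w.
Proof. by apply: val_inj; rewrite /= prednK// idx_gt0. Qed.

Lemma om_inj : injective om. Proof. by move=> i j /(congr1 (@nat_of_idx _)) []. Qed.

Section Coloring.
Variables (T : choiceType) (t0 : T).
Implicit Types (c : Omega -> T) (p : nat).

Definition colseq p c : seq T := mkseq (c \o om) p.

Definition bounded_col p c := forall w : Omega, (p < w)%N -> c w = t0.

Lemma size_colseq p c : size (colseq p c) = p. Proof. exact: size_mkseq. Qed.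

Lemma nth_colseq p c (w : Omega) : bounded_col p c ->
  nth t0 (colseq p c) (w : nat).-1 = c w.
Proof.
move=> cp; have [wp|wp] := leqP w p.
  by rewrite nth_mkseq ?prednK ?idx_gt0//= om_pred.
by rewrite nth_default ?cp// size_colseq -ltnS prednK// idx_gt0.
Qed.

Lemma bounded_col_le p p' c : (p <= p')%N -> bounded_col p c -> bounded_col p' c.
Proof. by move=> pp' cp w /(leq_ltn_trans pp')/cp. Qed.

Lemma colseq_add p d c : bounded_col p c ->
  colseq (p + d) c = colseq p c ++ nseq d t0.
Proof.
move=> cp; apply: (@eq_from_nth _ t0).
  by rewrite size_cat size_nseq !size_colseq.
move=> i; rewrite size_colseq => id; rewrite nth_cat nth_nseq size_colseq nth_mkseq//=.
have [ip|ip] := ltnP i p; first by rewrite nth_mkseq.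
by rewrite ltn_subLR// id cp.
Qed.

Lemma card_fiber p c x : bounded_col p c -> x != t0 ->
  [set w | c w = x] #= `I_(count_mem x (colseq p c)).
Proof.
move=> cp xt0; rewrite count_map -size_filter.
pose l := [seq om i | i <- iota 0 p & c (om i) == x].
have -> : [set w | c w = x] = [set` l].
  apply/seteqP; split=> w /=.
    move=> cw; apply/mapP; exists (w : nat).-1; last by rewrite om_pred.
    rewrite mem_filter om_pred cw eqxx mem_iota leq0n add0n /= prednK ?idx_gt0//.
    by rewrite leqNgt; apply/negP => /cp E; rewrite -cw E eqxx in xt0.
  by move=> /mapP[i]; rewrite mem_filter => /andP[/eqP + _] ->.
rewrite (_ : size _ = size l); last by rewrite size_map.
by apply: card_set_seq; rewrite map_inj_uniq ?filter_uniq ?iota_uniq//; exact: om_inj.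
Qed.

(** A rearrangement of the two sequences is a permutation of the positions below [p]; continued by
    the identity, it becomes an element of [perm]. *)
Lemma col_transport p c c' : bounded_col p c -> bounded_col p c' ->
  perm_eq (colseq p c) (colseq p c') -> exists g : perm, forall w, c' (g w) = c w.
Proof.
move=> cp c'p /(perm_iotaP t0)[Is]; rewrite size_colseq => IsP cE.
have sI : size Is = p by rewrite (perm_size IsP) size_iota.
have uI : uniq Is by rewrite (perm_uniq IsP) iota_uniq.
have memI i : (i \in Is) = (i < p)%N by rewrite (perm_mem IsP) mem_iota add0n.
(* [Is] lists the images of the positions in order, so [nth] applies the rearrangement and [index]
   inverts it. *)
pose f (w : Omega) := if (w <= p)%N then om (nth 0%N Is (w : nat).-1) else w.
pose f' (w : Omega) := if (w <= p)%N then om (index (w : nat).-1 Is) else w.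
have pred_lt (w : Omega) : ((w : nat).-1 < p)%N = (w <= p)%N.
  by rewrite -ltnS prednK ?idx_gt0.
have fK : cancel f f'.
  move=> w; rewrite /f' /f; have [wp|wp] := leqP w p; last by rewrite leqNgt wp.
  rewrite -pred_lt /= -memI mem_nth ?sI ?pred_lt// index_uniq ?sI ?pred_lt//.
  exact: om_pred.
have f'K : cancel f' f.
  move=> w; rewrite /f' /f; have [wp|wp] := leqP w p; last by rewrite leqNgt wp.
  have wI : (w : nat).-1 \in Is by rewrite memI pred_lt.
  by rewrite -pred_lt /= -[X in (_ < X)%N]sI index_mem wI nth_index// om_pred.
exists (Perm fK f'K) => w /=; rewrite /f; case: ifPn => wp; last first.
  by rewrite -ltnNge in wp; rewrite cp// c'p.
rewrite -(nth_colseq w cp) cE (nth_map 0%N) ?sI ?pred_lt//.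
by rewrite nth_mkseq// -memI mem_nth// sI pred_lt.
Qed.

End Coloring.

(** * Colorings and their profiles *)

Section Profile.
Variables (k : fieldType) (t : k).

(* The number of occurrences of x in s continued by "t - size s" copies of t0;
   it does not change when copies of t0 are appended to s. *)
Definition vcount (T : choiceType) (t0 : T) (s : seq T) (x : T) : k :=
  (count_mem x s)%:R + (if x == t0 then t - (size s)%:R else 0).

Definition profile (T : choiceType) (t0 : T) (c : Omega -> T) (A : T -> k) :=
  exists2 p, bounded_col t0 p c & vcount t0 (colseq p c) =1 A.

(** [f] and [g] are the projections of a product decomposition of [T], with inverse [h]. Occurrences
    add up over the fiber of [f], and the correction [t - size s] enters in the single term with
    [h u x' = t0]. *)
Lemma vcount_marginal (T T' U : choiceType) (t0 : T) (f : T -> T') (g : T -> U)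
    (h : U -> T' -> T) (fh : forall u x', f (h u x') = x')
    (gh : forall u x', g (h u x') = u) (hgf : forall x, h (g x) (f x) = x)
    (s : seq T) (x' : T') :
  vcount (f t0) (map f s) x' = \sum_(u \in [set: U]) vcount t0 s (h u x').
Proof.
have eqh u x y : (x == h u y) = (f x == y) && (g x == u).
  by apply/eqP/andP => [->|[/eqP <- /eqP <-]]; rewrite ?fh ?gh ?hgf.
(* Including [t0] in the list keeps the term that carries the correction, even if [t0] does not
   occur in [s]. *)
rewrite (@fsum_seq _ _ (undup (map g (t0 :: s)))) ?undup_uniq//; last first.
  move=> u; rewrite mem_undup => /mapP uP; rewrite /vcount.
  rewrite (_ : _ == _ = false) ?addr0; last first.
    by apply/negP => /eqP E; apply: uP; exists t0; rewrite ?mem_head// -E gh.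
  rewrite (count_memPn _)//; apply/negP => hs; apply: uP; exists (h u x') => //.
  by rewrite inE hs orbT.
have usum x y : x \in t0 :: s ->
    \sum_(u <- undup (map g (t0 :: s))) (x == h u y)%:R = (f x == y)%:R :> k.
  move=> xs; rewrite (bigD1_seq (g x)) ?undup_uniq ?mem_undup ?map_f//=.
  rewrite eqh eqxx andbT big1 ?addr0// => u /negPf ug.
  by rewrite eqh (eq_sym (g x)) ug andbF.
rewrite big_split /=; congr (_ + _); last first.
  rewrite size_map eq_sym.
  transitivity ((t - (size s)%:R) * (f t0 == x')%:R).
    by case: eqP; rewrite ?mulr1 ?mulr0.
  rewrite -usum ?mem_head// mulr_sumr; apply: eq_bigr => u _.
  by rewrite [_ == t0]eq_sym; case: eqP; rewrite ?mulr1 ?mulr0.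
rewrite count_map -sum1_count natr_sum.
under [RHS]eq_bigr do rewrite -sum1_count natr_sum big_mkcond /=.
rewrite exchange_big /= big_mkcond !big_seq; apply: eq_bigr => x xs.
transitivity ((f x == x')%:R : k); first by rewrite /preim /=; case: eqP.
rewrite -usum; last by rewrite inE xs orbT.
by apply: eq_bigr => u _; case: eqP.
Qed.

(** This is the marginal along the map to a point, where every entry of [s] counts and the
    correction restores [t]. *)
Lemma vcount_sum (T : choiceType) (t0 : T) (s : seq T) :
  \sum_(x \in [set: T]) vcount t0 s x = t.
Proof.
have := @vcount_marginal T unit T t0 (fun=> tt) id (fun x _ => x)
  (fun _ y => let: tt := y in erefl) (fun _ _ => erefl) (fun _ => erefl) s tt.
rewrite /= => <-; rewrite /vcount eqxx count_map (eq_count (a2 := predT)); last first.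
  by move=> x /=; rewrite eqxx.
by rewrite count_predT size_map addrC subrK.
Qed.

Section OneType.
Variables (T : choiceType) (t0 : T).
Implicit Types (c : Omega -> T) (A : T -> k).

Lemma vcount_pad (s : seq T) d : vcount t0 (s ++ nseq d t0) =1 vcount t0 s.
Proof.
move=> x; rewrite /vcount count_cat count_nseq size_cat size_nseq /= [t0 == x]eq_sym.
case: eqP => _; last by rewrite mul0n addn0.
by rewrite mul1n !natrD; ring.
Qed.

Lemma vcount_notin (s : seq T) x : x \notin t0 :: s -> vcount t0 s x = 0.
Proof.
rewrite inE negb_or => /andP[/negPf xt xs].
by rewrite /vcount xt addr0 (count_memPn xs).
Qed.

(** Padding both sequences to the length [maxn p p'] makes them equal, so a profile may be read off
    at any bound. *)
Lemma profile_colseq p c A : bounded_col t0 p c -> profile t0 c A ->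
  vcount t0 (colseq p c) =1 A.
Proof.
move=> cp [p' cp' cA] x; rewrite -cA.
rewrite -(vcount_pad (colseq p c) (maxn p p' - p)) -colseq_add//.
rewrite -(vcount_pad (colseq p' c) (maxn p p' - p')) -colseq_add//.
by rewrite !subnKC ?leq_maxl ?leq_maxr.
Qed.

Lemma profile_uniq c A A' : profile t0 c A -> profile t0 c A' -> A =1 A'.
Proof. by move=> [p cp cA] /(profile_colseq cp) cA' x; rewrite -cA -cA'. Qed.

Lemma profile_ext c c' A : c =1 c' -> profile t0 c A -> profile t0 c' A.
Proof. by move=> /funext ->. Qed.

Lemma profile_finite c A : profile t0 c A -> finite_set [set x | A x != 0].
Proof.
move=> [p cp cA]; apply: sub_finite_set (finite_seq (t0 :: colseq p c)) => x /=.
by apply: contraR => xs; rewrite -cA vcount_notin.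
Qed.

Lemma profile_sum c A : profile t0 c A -> \sum_(x \in [set: T]) A x = t.
Proof.
by move=> [p cp /funext <-]; exact: vcount_sum.
Qed.

Lemma profile_in_nat c A x : profile t0 c A -> x != t0 -> in_nat (A x).
Proof.
move=> [p cp cA] /negPf xt; rewrite -cA /vcount xt addr0.
by exists (count_mem x (colseq p c)).
Qed.

Lemma profile_in_tZ c A : profile t0 c A -> in_tZ t (A t0).
Proof.
move=> [p cp cA]; rewrite -cA /vcount eqxx.
exists (p%:Z - (count_mem t0 (colseq p c))%:Z).
by rewrite intrB opprB size_colseq addrCA addrA.
Qed.

(** The prescribed total forces the value at [t0]. This replaces counting for the color [t0], whose
    fiber is infinite. *)
Lemma eq_total (A B : T -> k) :
    finite_set [set x | A x != 0] -> finite_set [set x | B x != 0] ->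
    (forall x, x != t0 -> A x = B x) ->
    \sum_(x \in [set: T]) A x = \sum_(x \in [set: T]) B x -> A =1 B.
Proof.
move=> /finite_seqP[a aE] /finite_seqP[b bE] AB.
pose l := undup (t0 :: a ++ b).
have lP (C : T -> k) : (forall x, C x != 0 -> x \in a ++ b) ->
    \sum_(x \in [set: T]) C x = C t0 + \sum_(x <- l | x != t0) C x.
  move=> Cab; rewrite (@fsum_seq _ _ l) ?undup_uniq//; last first.
    move=> x; rewrite mem_undup inE negb_or => /andP[_].
    by apply: contraNeq => /Cab.
  by rewrite (bigD1_seq t0) ?undup_uniq// mem_undup mem_head.
rewrite !lP; first last.
- by move=> x Ax; rewrite mem_cat; have : [set x | A x != 0] x by []; rewrite aE /= => ->.
- move=> x Bx; rewrite mem_cat; have : [set x | B x != 0] x by [].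
  by rewrite bE /= => ->; rewrite orbT.
rewrite (eq_bigr B) => [/addIr E x|x]; last exact: AB.
by have [->|/AB] := eqVneq x t0.
Qed.

Hypothesis k0 : [pchar k] =i pred0.

(** For equal sizes the corrections cancel, and in characteristic zero the images of the
    multiplicities determine them. *)
Lemma vcount_perm (s s' : seq T) : size s = size s' ->
  vcount t0 s =1 vcount t0 s' -> perm_eq s s'.
Proof.
move=> ss E; apply/allP => x _ /=; have := E x.
by rewrite /vcount ss => /addIr/(natr_inj_char0 k0) ->.
Qed.

Lemma profile_transport c c' A : profile t0 c A -> profile t0 c' A ->
  exists g : perm, forall w, c' (g w) = c w.
Proof.
move=> [p cp cA] [p' cp' cA'].
apply: (@col_transport _ t0 (maxn p p')).
- exact: bounded_col_le (leq_maxl _ _) cp.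
- exact: bounded_col_le (leq_maxr _ _) cp'.
apply: vcount_perm; first by rewrite !size_colseq.
have cM := bounded_col_le (leq_maxl p p') cp.
have cM' := bounded_col_le (leq_maxr p p') cp'.
move=> x; rewrite (@profile_colseq _ _ A) ?(@profile_colseq _ c' A)//.
  by exists p'.
by exists p.
Qed.

(** Every color other than [t0] is listed as often as [A] prescribes; the value at [t0] then agrees
    by [eq_total]. *)
Lemma profile_exists A : (forall x, x != t0 -> in_nat (A x)) ->
    finite_set [set x | A x != 0] -> \sum_(x \in [set: T]) A x = t ->
  exists c, profile t0 c A.
Proof.
move=> An Afin At; have /finite_seqP[a aE] := Afin.
(* [t0] is removed because [A t0] need not be a natural number. *)
pose l := rem t0 (undup a).
pose s := flatten [seq nseq (natval (A x)) x | x <- l].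
have ul : uniq l by rewrite rem_uniq ?undup_uniq.
have sA x : x != t0 -> count_mem x s = natval (A x).
  move=> xt; rewrite count_flatten sumnE !big_map.
  have [xl|xl] := boolP (x \in l).
    rewrite (bigD1_seq x)//= count_nseq /= eqxx mul1n big1 ?addn0// => y /negPf yx.
    by rewrite count_nseq /= yx.
  rewrite big_seq big1.
    suff -> : A x = 0 by rewrite natval0.
    apply: contraNeq xl => Ax; rewrite mem_rem_uniq ?undup_uniq// inE xt /=.
    by rewrite mem_undup; have : [set x | A x != 0] x by []; rewrite aE.
  move=> y yl; rewrite count_nseq /=.
  by rewrite (_ : y == x = false)//; apply: contraNF xl => /eqP <-.
pose c (w : Omega) := nth t0 s (w : nat).-1.
have cp : bounded_col t0 (size s) c.
  by move=> w ws; rewrite /c nth_default// -ltnS prednK// idx_gt0.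
have cs : colseq (size s) c = s by rewrite /colseq -[RHS](mkseq_nth t0).
exists c; exists (size s) => //; rewrite cs.
apply: eq_total => //.
- apply: sub_finite_set (finite_seq (t0 :: s)) => x /=.
  by apply: contraR => /vcount_notin ->.
- by move=> x xt; rewrite /vcount (negPf xt) addr0 sA// natvalK//; exact: An.
- by rewrite vcount_sum.
Qed.

Lemma profile_card p c A : bounded_col t0 p c ->
    finite_set [set x | A x != 0] -> \sum_(x \in [set: T]) A x = t ->
    (forall x, x != t0 -> exists2 m : nat, [set w | c w = x] #= `I_m & A x = m%:R) ->
  profile t0 c A.
Proof.
move=> cp Afin At cA; exists p => //; apply: eq_total => //.
- apply: sub_finite_set (finite_seq (t0 :: colseq p c)) => x /=.
  by apply: contraR => /vcount_notin ->.
- move=> x xt; have [m cm ->] := cA x xt.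
  rewrite /vcount (negPf xt) addr0; congr _%:R; apply/card_eq_II.
  by apply: card_eq_trans cm; rewrite card_eq_sym; exact: (card_fiber cp xt).
- by rewrite vcount_sum.
Qed.

Lemma profile_cardE c A x : profile t0 c A -> x != t0 ->
  exists2 m : nat, [set w | c w = x] #= `I_m & A x = m%:R.
Proof.
move=> [p cp cA] xt; exists (count_mem x (colseq p c)); first exact: (card_fiber cp xt).
by rewrite -cA /vcount (negPf xt) addr0.
Qed.

End OneType.

Lemma profile_marginal (T T' U : choiceType) (t0 : T) (f : T -> T') (g : T -> U)
    (h : U -> T' -> T) (fh : forall u x', f (h u x') = x')
    (gh : forall u x', g (h u x') = u) (hgf : forall x, h (g x) (f x) = x)
    (c : Omega -> T) (A : T -> k) : profile t0 c A ->
  profile (f t0) (f \o c) (fun x' => \sum_(u \in [set: U]) A (h u x')).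
Proof.
move=> [p cp /funext <-]; exists p; first by move=> w /cp /= ->.
by move=> x'; rewrite -(vcount_marginal _ fh gh hgf) /colseq /mkseq -map_comp.
Qed.

End Profile.

(** * Counting words *)

Section Words.

Fixpoint words (J : Type) (js : seq J) p : seq (seq J) :=
  if p is p'.+1 then [seq j :: u | j <- js, u <- words js p'] else [:: [::]].

Lemma mem_words (J : eqType) (js : seq J) p (u : seq J) :
  (u \in words js p) = (size u == p) && all (mem js) u.
Proof.
elim: p u => [|p IHp] [|j u] //=; first by apply/allpairsP => -[[j u] []].
rewrite eqSS andbCA -IHp; apply/allpairsP/andP => [[[j' u'] /= [jj uu [-> ->]]]|[jj uu]].
  by [].
by exists (j, u).
Qed.

Lemma words_uniq (J : eqType) (js : seq J) p : uniq js -> uniq (words js p).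
Proof.
move=> ujs; elim: p => //= p IHp; apply: allpairs_uniq => //.
by move=> [j u] [j' u'] _ _ /= [-> ->].
Qed.

Variables (T J : eqType) (ts : seq T) (js : seq J).
Hypotheses (uts : uniq ts) (ujs : uniq js).

Definition has_counts (D : seq T) (A : T * J -> nat) (u : seq J) : bool :=
  `[< forall x, count_mem x (zip D u) = A x >].

(** The table that the remaining positions must realize once one position has been given the pair
    [x0]. *)
Definition decr (A : T * J -> nat) x0 x := (A x - (x == x0))%N.

Lemma has_counts_cons D A x j u :
  has_counts (x :: D) A (j :: u) = (0 < A (x, j))%N && has_counts D (decr A (x, j)) u.
Proof.
apply/asboolP/andP => [E|[A0 /asboolP E] y].
  split; first by rewrite -E /= eqxx.
  by apply/asboolP => y; rewrite /decr -E /= eq_sym addKn.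
rewrite /= E /decr eq_sym; case: eqP => [->|_]; first by rewrite subnKC.
by rewrite subn0.
Qed.

Lemma prod_fact_decr A x j : x \in ts -> j \in js -> (0 < A (x, j))%N ->
  (\prod_(y <- ts) \prod_(l <- js) (A (y, l))`! =
   A (x, j) * \prod_(y <- ts) \prod_(l <- js) (decr A (x, j) (y, l))`!)%N.
Proof.
move=> xts jjs A0; rewrite !(bigD1_seq x)//= !(bigD1_seq j)//= /decr eqxx subn1.
rewrite -[in LHS](prednK A0) factS !prednK// -!mulnA; do 2 congr (_ * _)%N.
congr (_ * _)%N.
  by apply: eq_bigr => l /negPf lj; rewrite xpair_eqE lj andbF subn0.
by apply: eq_bigr => y /negPf yx; apply: eq_bigr => l _; rewrite xpair_eqE yx subn0.
Qed.

(** This is the product over [x] of multinomial coefficients, with denominators cleared. In the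
    induction, the words starting with [j] contribute [A (x, j)] times the product of factorials for
    the tail, and summing over [j] gives [count_mem x D], the missing factor of the factorial. *)
Lemma count_words (D : seq T) (A : T * J -> nat) : {subset D <= ts} ->
    (forall x j, j \notin js -> A (x, j) = 0%N) ->
    (forall x, \sum_(j <- js) A (x, j) = count_mem x D)%N ->
  (count (has_counts D A) (words js (size D)) *
   \prod_(x <- ts) \prod_(j <- js) (A (x, j))`! = \prod_(x <- ts) (count_mem x D)`!)%N.
Proof.
elim: D A => [|x D IHD] A Dts Ajs AD.
  (* For empty [D] all row sums vanish, so the table is zero and the empty word realizes it. *)
  have A0 y j : A (y, j) = 0%N.
    have [jjs|/Ajs//] := boolP (j \in js).
    by have /eqP := AD y; rewrite sum_nat_seq_eq0 => /allP/(_ _ jjs)/eqP.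
  rewrite /= (_ : has_counts _ _ _); last by apply/asboolP => -[y j]; rewrite A0.
  rewrite mul1n !big1// => y _; rewrite big1// => j _; by rewrite A0.
have xts : x \in ts by apply: Dts; rewrite mem_head.
have DD : {subset D <= ts} by move=> y yD; apply: Dts; rewrite inE yD orbT.
rewrite /= count_flatten sumnE !big_map big_distrl /=.
have IH j : j \in js ->
    (count (has_counts (x :: D) A) [seq j :: u | u <- words js (size D)] *
     \prod_(x <- ts) \prod_(j <- js) (A (x, j))`! =
     A (x, j) * \prod_(y <- ts) (count_mem y D)`!)%N.
  move=> jjs; rewrite count_map (eq_count (has_counts_cons D A x j)).
  have [A0|A0] := posnP (A (x, j)); first by rewrite A0 count_pred0.
  rewrite (prod_fact_decr xts jjs A0) mulnCA; congr (_ * _)%N.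
  rewrite -(IHD (decr A (x, j)))//.
    by move=> y l /Ajs; rewrite /decr => ->.
  (* Using the pair [(x, j)] lowers by one the sum of row [x] and leaves the other rows unchanged,
     which matches dropping [x] from the sequence. *)
  move=> y; apply/eqP; rewrite -(eqn_add2l (x == y)) -[X in _ == X](AD y); apply/eqP.
  have [<-|/negPf xy] := eqVneq x y; last first.
    apply: eq_bigr => l _; by rewrite /decr xpair_eqE eq_sym xy subn0.
  rewrite !(bigD1_seq j)//= /decr eqxx addnA subnKC//; congr (_ + _)%N.
  by apply: eq_bigr => l /negPf lj; rewrite xpair_eqE lj andbF subn0.
rewrite big_seq (eq_bigr _ IH) -big_seq -big_distrl /= AD /= eqxx add1n.
rewrite !(bigD1_seq x)//= eqxx add1n factS mulnA; congr (_ * _)%N.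
by apply: eq_bigr => y /negPf yx; rewrite eq_sym yx.
Qed.

End Words.

(** * Points of X_ b as colorings, and the basis xi *)

Section SchurAlgebra.
Variables (k : fieldType) (t : k) (n : option nat).
Local Notation I := (idx n).
Variables (i1 : I) (i1E : i1 = 1%N :> nat) (k0 : [pchar k] =i pred0).

Lemma eq_i1 (j : I) : (j == 1%N :> nat) = (j == i1).
Proof. by rewrite -i1E; apply/eqP/eqP => [/val_inj|->]. Qed.

Lemma neq_i1 (j : I) : (j != i1) = (2 <= j)%N.
Proof. by rewrite -eq_i1 neq_ltn ltnS leqn0 -[_ == 0%N]negbK -lt0n idx_gt0. Qed.

Lemma finite_idx_le m : finite_set [set i : I | (i <= m)%N].
Proof.
apply/finite_set_leP; exists m.+1.
by apply: (@card_ge_preimage _ _ `I_m.+1 (@nat_of_idx n)) => i j _ _ /= /val_inj.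
Qed.

Section OneWeight.
Variable b : I -> k.

Lemma psum_pred (j : I) : (2 <= j)%N -> psum b j = (psum b (j : nat).-1 + natval (b j))%N.
Proof.
move=> j2; have jK : (j : nat).-1.+1 = j by rewrite prednK// idx_gt0.
rewrite /psum (fsbigD1 j) /=; first last.
- by rewrite j2 leqnn.
- by apply: sub_finite_set (finite_idx_le j) => i /= /andP[].
rewrite -[RHS]addrC; congr (_ + _); apply: eq_fsbigl.
apply/seteqP; split=> i /= => [[/andP[i2 ij] /eqP ne]|/andP[i2 ij]].
  by rewrite i2 -ltnS jK ltn_neqAle ij andbT.
have lt : (i < j)%N by rewrite -jK ltnS.
by split; [rewrite i2 ltnW | move=> E; rewrite E ltnn in lt].
Qed.

Lemma psum_mono m m' : (m <= m')%N -> (psum b m <= psum b m')%N.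
Proof.
move=> /subnK <-; elim: (m' - m)%N => [|d IHd]; first by rewrite add0n.
apply: leq_trans IHd _; rewrite addSn; set p := (d + m)%N.
have [/andP[p1 pn]|/negP np] := boolP ((2 <= p.+1)%N && in_range n p.+1).
  by rewrite (@psum_pred (Idx pn) p1) leq_addr.
(* Here [p.+1] is not an index of a summand, so the two sums range over the same set. *)
suff -> : psum b p = psum b p.+1 by [].
rewrite /psum; apply: eq_fsbigl; apply/seteqP; split=> i /= /andP[i2 ip].
  by rewrite i2 leqW.
rewrite i2 -ltnS ltn_neqAle ip andbT; apply/eqP => E; apply: np.
by rewrite -E i2; case: i {i2 ip E}.
Qed.

Lemma card_interval_block (j : I) : (2 <= j)%N ->
  interval_block b j #= `I_(natval (b j)).
Proof.
move=> j2; pose l := [seq om i | i <- iota (psum b (j : nat).-1) (natval (b j))].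
have -> : interval_block b j = [set` l].
  apply/seteqP; split=> w /=.
    move=> /andP[w1 w2]; apply/mapP; exists (w : nat).-1; last by rewrite om_pred.
    have wK : (w : nat).-1.+1 = w by rewrite prednK// idx_gt0.
    by rewrite mem_iota -psum_pred// wK w2 andbT -ltnS wK -add1n.
  by move=> /mapP[i]; rewrite mem_iota -psum_pred// => ij ->.
have -> : natval (b j) = size l by rewrite size_map size_iota.
by apply: card_set_seq; rewrite map_inj_uniq ?iota_uniq//; exact: om_inj.
Qed.

Lemma interval_block_inj (j l : I) (w : Omega) :
  interval_block b j w -> interval_block b l w -> j = l.
Proof.
wlog: j l / (j <= l)%N => [W|].
  by have [/W//|/ltnW/W H jw lw] := leqP j l; apply/esym/H.
rewrite leq_eqVlt => /orP[/eqP/val_inj //|jl] /andP[_ w1] /andP[w2 _].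
have : (psum b j <= psum b (l : nat).-1)%N.
  by apply: psum_mono; rewrite -ltnS prednK// idx_gt0.
by move=> /(leq_trans w1)/leq_ltn_trans/(_ w2); rewrite ltnn.
Qed.

(** The blocks partition Omega, so the default [i1] of [xget] is never reached. *)
Definition block_col (w : Omega) : I := xget i1 [set j | block b j w].

Lemma block_colP (j : I) w : block b j w <-> block_col w = j.
Proof.
have blockN (l : I) : l != i1 -> block b l = interval_block b l.
  by rewrite /block eq_i1 => /negPf ->.
have block1 : block b i1 w -> forall l : I, l != i1 -> ~ interval_block b l w.
  rewrite /block i1E eqxx => nw l; rewrite neq_i1 => l2 lw.
  by apply: nw; exists l.
have ex : exists j, block b j w.
  have [[l l2 lw]|nw] := pselect
      ((\bigcup_(l in [set l : I | (2 <= l)%N]) interval_block b l) w).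
    by exists l; rewrite blockN// neq_i1.
  by exists i1; rewrite /block i1E eqxx.
have inj l l' : block b l w -> block b l' w -> l = l'.
  have [->|l1] := eqVneq l i1; have [->//|l1'] := eqVneq l' i1.
  - by move=> /block1/(_ _ l1'); rewrite (blockN l').
  - by move=> + /block1/(_ _ l1); rewrite (blockN l).
  - by rewrite !blockN//; exact: interval_block_inj.
split=> [jw|<-]; last exact: (xgetPex i1 ex).
by apply: xget_unique => // l lw; exact: inj.
Qed.

(** The Young subgroup is thus the stabilizer of the block coloring, which turns cosets into
    colorings. *)
Lemma YoungP (g : perm) : Young b g <-> forall w, block_col (g w) = block_col w.
Proof.
split=> [gY w|gY j].
  by apply/block_colP; rewrite -gY; exists w => //; exact/block_colP.
apply/seteqP; split=> [_ [w /block_colP jw <-]|w /block_colP jw].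
  by apply/block_colP; rewrite gY.
exists ((g^-1)%g w); last by rewrite /= perm_invK.
by apply/block_colP; rewrite -gY /= perm_invK.
Qed.

Lemma block_col_bounded : finite_set [set j | b j != 0] ->
  exists p, bounded_col i1 p block_col.
Proof.
move=> /finite_seqP[s sE]; exists (\max_(j <- s) psum b j)%N => w wp.
apply: contraPP (ltnn (\max_(j <- s) psum b j)) => /eqP wj _.
suff /(leq_trans wp) : (w <= \max_(j <- s) psum b j)%N by rewrite ltnn.
set j := block_col w in wj; have : block b j w by exact/block_colP.
rewrite /block eq_i1 (negPf wj) => jw.
have bj : b j != 0.
  by apply/eqP => b0; move: jw; rewrite interval_block0// -neq_i1.
have js : j \in s by have : [set j | b j != 0] j by []; rewrite sE.
by apply: leq_trans (leq_bigmax_seq _ js _) => //; case/andP: jw.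
Qed.

Lemma block_col_profile : Lam n t b -> profile t i1 block_col b.
Proof.
move=> [bn finb bt]; have [p cp] := block_col_bounded finb.
apply: (profile_card cp finb bt) => j j1; exists (natval (b j)).
  have -> : [set w | block_col w = j] = interval_block b j.
    have : block b j = interval_block b j by rewrite /block eq_i1 (negPf j1).
    by move=> <-; apply/seteqP; split=> w /= /block_colP.
  by apply: card_interval_block; rewrite -neq_i1.
by rewrite natvalK//; have := bn j; rewrite eq_i1 (negPf j1).
Qed.

End OneWeight.

Section Points.
Variable b : Lam n t.

(** The coset of [g] corresponds to the block coloring transported by [g]. By [pt_colE] the
    representative chosen by [xget] does not matter. *)
Definition pt_col (x : X_ b) (w : Omega) : I :=
  block_col (val b) (((xget 1%g (val x : set perm))^-1)%g w).

Lemma coset_repr (x : X_ b) : exists g, x = coset_of_perm (Young (val b)) g.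
Proof. by have := valP x; rewrite inE => -[g _ gx]; exists g; apply: val_inj. Qed.

Lemma pt_colE (g : perm) (w : Omega) :
  pt_col (coset_of_perm (Young (val b)) g) w = block_col (val b) ((g^-1)%g w).
Proof.
rewrite /pt_col (_ : val _ = lcoset g (Young (val b)))//; set C := lcoset _ _.
have : C (xget 1%g C).
  apply: xgetPex; exists g; exists 1%g; last by rewrite mulg1.
  by apply/YoungP.
move: (xget _ _) => _ [y yY <-]; rewrite invgM permEM.
by have /YoungP := YoungV yY => ->.
Qed.

Lemma pt_col_act (g : perm) (x : X_ b) w : pt_col (act g x) w = pt_col x ((g^-1)%g w).
Proof.
have [h ->] := coset_repr x.
have -> : act g (coset_of_perm (Young (val b)) h : X_ b) =
    coset_of_perm (Young (val b)) (g * h)%g.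
  by apply: val_inj; rewrite /= lcosetM.
by rewrite !pt_colE invgM permEM.
Qed.

Lemma pt_col_inj (x y : X_ b) : pt_col x =1 pt_col y -> x = y.
Proof.
have [g ->] := coset_repr x; have [h ->] := coset_repr y => E.
apply: val_inj => /=; have -> : h = (g * (g^-1 * h))%g by rewrite mulgA mulgV mul1g.
rewrite [RHS]lcosetM; congr (lcoset _ _); apply/esym.
apply: (lcoset_id (@YoungM _ _ (val b)) (@YoungV _ _ (val b))).
apply/YoungP => w; have := E (h w); rewrite !pt_colE permEM => ->.
by rewrite -permEM mulVg.
Qed.

(** [g] maps the fibers of [c \o g] bijectively onto those of [c], and the sizes of the fibers away
    from [t0] determine the profile. *)
Lemma profile_perm (T : choiceType) (t0 : T) (c : Omega -> T) (A : T -> k) (g : perm) :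
  profile t t0 c A -> profile t t0 (c \o g) A.
Proof.
move=> cA; have [p cp _] := cA.
have [p' _ p'P] := perm_bound (g^-1)%g p.
have cgp : bounded_col t0 (maxn p p') (c \o g).
  move=> w wp /=; apply: cp; rewrite ltnNge; apply/negP => /p'P.
  rewrite -permEM mulVg leqNgt => /negP; apply; apply: leq_ltn_trans wp.
  exact: leq_maxr.
apply: (profile_card cgp); [exact: profile_finite cA | exact: profile_sum cA |].
move=> x xt; have [m cm Am] := profile_cardE cA xt; exists m => //.
apply: card_eq_trans cm.
have -> : [set w | c w = x] = g @` [set w | (c \o g) w = x].
  apply/seteqP; split=> [w <-|_ [w /= + <-]//].
  by exists ((g^-1)%g w); rewrite /= ?perm_invK.
by rewrite card_eq_sym; apply: inj_card_eq => w w' _ _; exact: (can_inj (perm_funK g)).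
Qed.

Lemma pt_col_profile (x : X_ b) : profile t i1 (pt_col x) (val b).
Proof.
have [g ->] := coset_repr x.
apply: (@profile_ext _ _ _ _ (block_col (val b) \o (g^-1)%g)).
  by move=> w; rewrite pt_colE.
by apply: profile_perm; apply: block_col_profile; have := valP b; rewrite inE.
Qed.

(** [c] and the block coloring have the same profile, so a permutation carries one to the other; its
    inverse represents the coset. *)
Lemma pt_col_surj (c : Omega -> I) : profile t i1 c (val b) ->
  exists x : X_ b, pt_col x =1 c.
Proof.
have /block_col_profile bb : Lam n t (val b) by have := valP b; rewrite inE.
move=> cb; have [g gP] := profile_transport k0 cb bb.
by exists (coset_of_perm (Young (val b)) (g^-1)%g) => w; rewrite pt_colE invgK gP.
Qed.

End Points.

(** * Relative positions of two points and expansion in the basis *)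

Section Positions.

Definition pair_col (b d : Lam n t) (y : X_ d) (x : X_ b) (w : Omega) : I * I :=
  (pt_col y w, pt_col x w).

Definition has_position (b d : Lam n t) (y : X_ d) (x : X_ b) (q : I -> I -> k) :=
  profile t (i1, i1) (pair_col y x) (fun p => q p.1 p.2).

Lemma eq_i1_pair (i j : I) :
  (i == 1%N :> nat) && (j == 1%N :> nat) = ((i, j) == (i1, i1)).
Proof. by rewrite !eq_i1. Qed.

Lemma profile_fst (c : Omega -> I * I) (A : I * I -> k) : profile t (i1, i1) c A ->
  profile t i1 (fst \o c) (fun i => \sum_(j \in [set: I]) A (i, j)).
Proof. by apply: (@profile_marginal _ _ _ _ _ _ fst snd (fun j i => (i, j))) => // -[]. Qed.

Lemma profile_snd (c : Omega -> I * I) (A : I * I -> k) : profile t (i1, i1) c A ->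
  profile t i1 (snd \o c) (fun j => \sum_(i \in [set: I]) A (i, j)).
Proof. by apply: (@profile_marginal _ _ _ _ _ _ snd fst pair) => // -[]. Qed.

(** The row and column sums are the marginals of the pair coloring, that is, the profiles of [y] and
    [x]. *)
Lemma Mat_of_position (b d : Lam n t) (y : X_ d) (x : X_ b) q :
  has_position y x q -> Mat t (val d) (val b) q.
Proof.
move=> yxq; split.
- move=> i j; rewrite eq_i1_pair; case: eqP => [E|/eqP ne].
    by have := profile_in_tZ yxq; rewrite -E.
  exact: profile_in_nat yxq ne.
- exact: profile_finite yxq.
- exact: profile_sum yxq.
- by move=> j; apply: profile_uniq (profile_snd yxq) (pt_col_profile x) j.
- by move=> i; apply: profile_uniq (profile_fst yxq) (pt_col_profile y) i.
Qed.

Lemma has_position_act (b d : Lam n t) (y : X_ d) (x : X_ b) q g :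
  has_position y x q -> has_position (act g y) (act g x) q.
Proof.
move=> /(profile_perm (g^-1)%g); apply: profile_ext => w.
by rewrite /pair_col /= !pt_col_act.
Qed.

Lemma position_exists (b d : Lam n t) q : Mat t (val d) (val b) q ->
  exists (y : X_ d) (x : X_ b), has_position y x q.
Proof.
move=> [qn qfin qt qb qd].
have [] := @profile_exists _ t _ (i1, i1) k0 (fun p => q p.1 p.2) _ qfin qt.
  by move=> [i j] /negPf ij; have := qn i j; rewrite eq_i1_pair ij.
move=> c cq.
have [|y yP] := @pt_col_surj d (fst \o c).
  by have := profile_fst cq; congr profile; apply/funext.
have [|x xP] := @pt_col_surj b (snd \o c).
  by have := profile_snd cq; congr profile; apply/funext.
exists y, x; apply: profile_ext cq => w.
by rewrite /pair_col yP xP -surjective_pairing.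
Qed.

Lemma position_orbit (b d : Lam n t) (y y' : X_ d) (x x' : X_ b) q :
    has_position y x q -> has_position y' x' q ->
  exists g, y' = act g y /\ x' = act g x.
Proof.
move=> yxq y'x'q; have [g gP] := profile_transport k0 y'x'q yxq.
have E w : pair_col y x (g w) = pair_col y' x' w by exact: gP.
exists (g^-1)%g; split; apply: pt_col_inj => w; rewrite pt_col_act invgK;
  by case: (E w).
Qed.

Lemma position_bounded (b d : Lam n t) (y : X_ d) (x : X_ b) :
  exists p, bounded_col (i1, i1) p (pair_col y x).
Proof.
have [p yp _] := pt_col_profile y; have [p' xp _] := pt_col_profile x.
exists (maxn p p') => w; rewrite gtn_max => /andP[wp wp'].
by rewrite /pair_col yp ?xp.
Qed.

(** The intersections of blocks in [rel_position] are the fibers of the pair coloring. The cell (1,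
    1), which [rel_position] leaves out, is fixed by the total [t]. *)
Lemma rel_positionP (b d : Lam n t) q sigma : Mat t (val d) (val b) q ->
  rel_position (val d) (val b) q sigma <->
  has_position (coset_of_perm (Young (val d)) 1%g : X_ d)
               (coset_of_perm (Young (val b)) sigma : X_ b) q.
Proof.
set y : X_ d := coset_of_perm _ _; set x : X_ b := coset_of_perm _ _ => qM.
have fibE i j : block (val d) i `&` sigma @` block (val b) j =
    [set w | pair_col y x w = (i, j)].
  apply/seteqP; split=> w /=; rewrite /pair_col /x /y !pt_colE invg1.
    by move=> [/block_colP wi [w' /block_colP w'j E]]; rewrite wi -E /= perm_funK w'j.
  move=> [/block_colP wi /block_colP wj]; split=> //.
  by exists ((sigma^-1)%g w); rewrite //= perm_invK.
have [qn qfin qt _ _] := qM; split=> [sq|yxq i j ij].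
  have [p yxp] := position_bounded y x.
  apply: (profile_card yxp qfin qt) => -[i j] ij.
  by have [|m] := sq i j; [rewrite eq_i1_pair | rewrite fibE; exists m].
rewrite eq_i1_pair in ij; have [m] := profile_cardE yxq ij.
by exists m => //; rewrite fibE.
Qed.

Lemma xi_homE (b d : Lam n t) q (y : X_ d) (x : X_ b) : Mat t (val d) (val b) q ->
  xi_hom b d q (y, x) = `[< has_position y x q >]%:R.
Proof.
move=> qM; rewrite /= /xi_fun; set sigma := xget _ _.
have sq : rel_position (val d) (val b) q sigma.
  (* Some [sigma] exists, so [xget] does not default: a pair in position [q] is moved until its
     first point is the base coset, and its second point then supplies [sigma]. *)
  apply: xgetPex; have [y0 [x0 P0]] := position_exists qM.
  have [g gE] := coset_repr y0.
  have [h hE] := coset_repr (act (g^-1)%g x0 : X_ b).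
  exists h; apply/(rel_positionP _ qM); rewrite -hE.
  have <- : act (g^-1)%g y0 = (coset_of_perm (Young (val d)) 1%g : X_ d).
    by rewrite gE; apply: val_inj; rewrite /= -lcosetM mulVg.
  exact: has_position_act.
have P1 := (rel_positionP _ qM).1 sq.
congr (nat_of_bool _)%:R; apply: asbool_equiv_eq; split=> [[g [-> ->]]|yxq].
  exact: has_position_act.
by have [g [-> ->]] := position_orbit P1 yxq; exists g.
Qed.

Lemma xiE (q : Matn n t) (b d : Lam n t) (y : X_ d) (x : X_ b) :
  xi q (b, d) (y, x) = `[< has_position y x (val q) >]%:R.
Proof.
rewrite /=; case: ifPn => /asboolP qM; first by rewrite xi_homE.
by case: asboolP => // /Mat_of_position.
Qed.

Lemma position_of_pair (b d : Lam n t) (y : X_ d) (x : X_ b) :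
  exists s : Matn n t, has_position y x (val s).
Proof.
have [p yxp] := position_bounded y x.
pose q i j := vcount t (i1, i1) (colseq p (pair_col y x)) (i, j).
have yxq : has_position y x q by exists p => // -[].
have qM : q \in Matn n t.
  rewrite inE; exists (val d), (val b).
  by have := valP d; have := valP b; rewrite !inE; split=> //; exact: Mat_of_position yxq.
by exists (exist _ q qM).
Qed.

Lemma position_inj (b d : Lam n t) (y : X_ d) (x : X_ b) (s s' : Matn n t) :
  has_position y x (val s) -> has_position y x (val s') -> s = s'.
Proof.
move=> ys ys'; apply: val_inj; apply/funext => i; apply/funext => j.
exact: (profile_uniq ys ys' (i, j)).
Qed.

Lemma Matn_position (s : Matn n t) :
  exists (b d : Lam n t) (y : X_ d) (x : X_ b), has_position y x (val s).
Proof.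
have := valP s; rewrite inE => -[d [b [dL bL sM]]].
rewrite -in_setE in dL; rewrite -in_setE in bL.
have [y [x yx]] := @position_exists (exist _ b bL) (exist _ d dL) _ sM.
by exists (exist _ b bL), (exist _ d dL), y, x.
Qed.

(** At a pair in position [s] every other basis element vanishes, so a combination takes there its
    coefficient of [xi s]. This shows both that [C] is an expansion of [F] and that any expansion
    picked by [xget] equals [C]. *)
Lemma xi_coord_unique (F : schur n t) (C : Matn n t -> k) :
    finite_set [set s | C s != 0] ->
    (forall (b d : Lam n t) (y : X_ d) (x : X_ b) (s : Matn n t),
      has_position y x (val s) -> F (b, d) (y, x) = C s) ->
  xi_coord F =1 C.
Proof.
move=> Cfin FC.
have sumE (c : Matn n t -> k) (b d : Lam n t) (y : X_ d) (x : X_ b) (s : Matn n t) :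
    finite_set [set s | c s != 0] -> has_position y x (val s) ->
    (\sum_(s' \in [set: Matn n t]) c s' *: xi s' : schur n t) (b, d) (y, x) = c s.
  move=> /finite_seqP[l lE] yxs.
  rewrite (@fsum_seq _ _ (undup (s :: l))) ?undup_uniq//; last first.
    move=> s'; rewrite mem_undup inE negb_or => /andP[_ s'l].
    suff -> : c s' = 0 by rewrite scale0r.
    apply: contraNeq s'l => cs'.
    by have : [set s | c s != 0] s' by []; rewrite lE.
  rewrite (big_morph (fun G : schur n t => G (b, d) (y, x)) (id1 := 0) (op1 := +%R))//.
  rewrite (bigD1_seq s) ?undup_uniq ?mem_undup ?mem_head//=.
  rewrite big1 => [|s' s's]; last first.
    transitivity (c s' * xi s' (b, d) (y, x)); first by [].
    rewrite xiE; case: asboolP; last by rewrite mulr0.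
    by move=> /(position_inj yxs) E; rewrite E eqxx in s's.
  transitivity (c s * xi s (b, d) (y, x)); first by rewrite addr0.
  by rewrite xiE; case: asboolP => // _; rewrite mulr1.
have CP : finite_set [set s | C s != 0] /\ F = \sum_(s \in [set: Matn n t]) C s *: xi s.
  split=> //; apply: dsum_eqP => -[b d]; apply: val_inj; apply/funext => -[y x].
  have [s yxs] := position_of_pair y x.
  exact: etrans (FC _ _ _ _ _ yxs) (esym (sumE _ _ _ _ _ _ Cfin yxs)).
pose P := [set c : Matn n t -> k | finite_set [set s | c s != 0] /\
  F = \sum_(s \in [set: Matn n t]) c s *: xi s].
have [cfin cE] : P (xi_coord F) by apply: (@xgetI _ _ P C).
move=> s; have [b [d [y [x yxs]]]] := Matn_position s.
by rewrite -(FC _ _ _ _ _ yxs) {2}cE (sumE _ _ _ _ _ _ cfin yxs).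
Qed.

End Positions.

(** * Arrays *)

Section Arrays.

Lemma finite_set_inj (T U : Type) (f : T -> U) (S : set T) :
  {in S &, injective f} -> finite_set (f @` S) -> finite_set S.
Proof. by move=> /inj_card_eq/eq_finite_set ->. Qed.

Lemma natval_sum_le (T : choiceType) (F : T -> k) (x : T) :
    (forall y, in_nat (F y)) -> finite_set [set y | F y != 0] ->
  (natval (F x) <= natval (\sum_(y \in [set: T]) F y))%N.
Proof.
move=> Fn /finite_seqP[l lE].
rewrite (@fsum_seq _ _ (undup (x :: l))) ?undup_uniq//; last first.
  move=> y; rewrite mem_undup inE negb_or => /andP[_].
  by apply: contraNeq => Fy; have : [set y | F y != 0] y by []; rewrite lE.
rewrite (in_nat_sumE k0)// (natval_nat k0).
by rewrite (bigD1_seq x) ?undup_uniq ?mem_undup ?mem_head//= leq_addr.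
Qed.

Lemma natval_eq0 (x : k) : in_nat x -> natval x = 0%N -> x = 0.
Proof. by move=> xn x0; rewrite -(natvalK k0 xn) x0. Qed.

Section Marginals.
Variables q r s : I -> I -> k.
Implicit Type A : I -> I -> I -> k.

Lemma Arr_in_nat A i j l : Arr t q r s A -> ~~ [&& i == i1, j == i1 & l == i1] ->
  in_nat (A i j l).
Proof. by move=> [An _ _ _ _] /negPf ijl; have := An i j l; rewrite !eq_i1// ijl. Qed.

Lemma Arr_finite3 A i j : Arr t q r s A -> finite_set [set l | A i j l != 0].
Proof.
move=> [_ Afin _ _ _]; apply: sub_finite_set (finite_image snd Afin) => l /= Al.
by exists (i, j, l).
Qed.

Lemma Arr_finite1 A j l : Arr t q r s A -> finite_set [set i | A i j l != 0].
Proof.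
move=> [_ Afin _ _ _]; apply: sub_finite_set (finite_image (fst \o fst) Afin) => i /= Ai.
by exists (i, j, l).
Qed.

Lemma Arr_le_q A i j l : Arr t q r s A -> ~~ ((i == i1) && (j == i1)) ->
  (natval (A i j l) <= natval (q i j))%N.
Proof.
move=> AA ij; have [_ _ <- _ _] := AA.
apply: (natval_sum_le (F := A i j)); last exact: Arr_finite3 AA.
by move=> l'; apply: Arr_in_nat AA _; apply: contra ij => /and3P[-> ->].
Qed.

Lemma Arr_le_r A i j l : Arr t q r s A -> ~~ ((j == i1) && (l == i1)) ->
  (natval (A i j l) <= natval (r j l))%N.
Proof.
move=> AA jl; have [_ _ _ <- _] := AA.
apply: (natval_sum_le (F := fun i => A i j l)); last exact: Arr_finite1 AA.
by move=> i'; apply: Arr_in_nat AA _; rewrite negb_and jl orbT.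
Qed.

Variable js : seq I.
Hypotheses (i1js : i1 \in js)
  (qjs : forall i j, q i j != 0 -> (i \in js) && (j \in js))
  (rjs : forall j l, r j l != 0 -> (j \in js) && (l \in js)).

(** If [i] or [j] lies outside [js], the entry is bounded by [q i j = 0]; if only [l] does, it is
    bounded by [r j l = 0]. The corner entry, to which no bound applies, has its indices in [js]. *)
Lemma Arr_supp A i j l : Arr t q r s A -> A i j l != 0 ->
  [&& i \in js, j \in js & l \in js].
Proof.
move=> AA; apply: contraNT => ijl; apply/eqP/natval_eq0.
  apply: Arr_in_nat AA _; apply: contra ijl => /and3P[/eqP -> /eqP -> /eqP ->].
  by rewrite i1js.
apply/eqP; rewrite -leqn0; have [ij|ij] := boolP ((i \in js) && (j \in js)).
  have lN : l \notin js by apply: contra ijl => ->; rewrite andbT ij.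
  suff <- : natval (r j l) = 0%N.
    apply: Arr_le_r AA _; apply: contra lN => /andP[_ /eqP ->]; exact: i1js.
  suff -> : r j l = 0 by rewrite natval0.
  by apply: contraNeq lN => /rjs/andP[].
suff <- : natval (q i j) = 0%N.
  apply: Arr_le_q AA _; apply: contra ij => /andP[/eqP -> /eqP ->]; by rewrite i1js.
suff -> : q i j = 0 by rewrite natval0.
by apply: contraNeq ij => /qjs.
Qed.

Hypothesis ujs : uniq js.

Lemma Arr_sum_q A i j : Arr t q r s A -> q i j = \sum_(l <- js) A i j l.
Proof.
move=> AA; have [_ _ <- _ _] := AA; apply: fsum_seq => // l.
by apply: contraNeq => /(Arr_supp AA)/and3P[].
Qed.

Lemma Arr_sum_r A j l : Arr t q r s A -> r j l = \sum_(i <- js) A i j l.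
Proof.
move=> AA; have [_ _ _ <- _] := AA; apply: fsum_seq => // i.
by apply: contraNeq => /(Arr_supp AA)/and3P[].
Qed.

Lemma Arr_sum_s A i l : Arr t q r s A -> s i l = \sum_(j <- js) A i j l.
Proof.
move=> AA; have [_ _ _ _ <-] := AA; apply: fsum_seq => // j.
by apply: contraNeq => /(Arr_supp AA)/and3P[].
Qed.

Lemma Arr_supp_s A i l : Arr t q r s A -> s i l != 0 -> (i \in js) && (l \in js).
Proof.
move=> AA; rewrite (Arr_sum_s i l AA); apply: contraNT => il.
rewrite big1// => j _; apply: contraNeq il => /(Arr_supp AA).
by case/and3P => -> _ ->.
Qed.

End Marginals.

(** All [s] are treated at once, so that the product also has finitely many nonzero coefficients. An
    array is encoded by its entries off the corner, a word over a bounded alphabet. *)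
Lemma finite_Arr (q r : I -> I -> k) : finite_set [set p | q p.1 p.2 != 0] ->
    finite_set [set p | r p.1 p.2 != 0] ->
  finite_set [set A | exists s, Arr t q r s A].
Proof.
move=> /finite_seqP[ql qlE] /finite_seqP[rl rlE].
pose js := undup (i1 :: [seq p.1 | p <- ql ++ rl] ++ [seq p.2 | p <- ql ++ rl]).
have inl (m : I -> I -> k) (l : seq (I * I)) i j :
    {subset l <= ql ++ rl} -> [set p | m p.1 p.2 != 0] = [set` l] -> m i j != 0 ->
    (i \in js) && (j \in js).
  move=> lqr mE mij.
  have ijl : (i, j) \in ql ++ rl.
    by apply: lqr; have : [set p | m p.1 p.2 != 0] (i, j) by []; rewrite mE.
  by rewrite !mem_undup !inE !mem_cat (map_f fst ijl) (map_f snd ijl) !orbT.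
have qjs i j : q i j != 0 -> (i \in js) && (j \in js).
  by apply: inl qlE => p pq; rewrite mem_cat pq.
have rjs j l : r j l != 0 -> (j \in js) && (l \in js).
  by apply: inl rlE => p pr; rewrite mem_cat pr orbT.
have i1js : i1 \in js by rewrite mem_undup mem_head.
pose ix := [seq x <- [seq (x, l) | x <- [seq (i, j) | i <- js, j <- js], l <- js]
              | x != (i1, i1, i1)].
pose code (A : I -> I -> I -> k) := [seq natval (A x.1.1 x.1.2 x.2) | x <- ix].
pose B := (\sum_(i <- js) \sum_(j <- js) (natval (q i j) + natval (r i j)))%N.
have qrB i j : i \in js -> j \in js -> (natval (q i j) + natval (r i j) <= B)%N.
  move=> ijs jjs; rewrite /B (bigD1_seq i) ?undup_uniq//=.
  rewrite (bigD1_seq j) ?undup_uniq//=.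
  exact: leq_trans (leq_addr _ _) (leq_addr _ _).
apply: (@finite_set_inj _ _ code); last first.
  apply: sub_finite_set (finite_seq (words (iota 0 B.+1) (size ix))) => _ [A [s AA] <-] /=.
  rewrite mem_words size_map eqxx; apply/allP => m /mapP[x + ->].
  rewrite mem_filter => /andP[x1 xix].
  have /allpairsP[[y l] /= [yjs ljs xE]] := xix.
  have /allpairsP[[i j] /= [ijs jjs yE]] := yjs.
  rewrite xE yE /= in x1 *.
  change (natval (A i j l) \in iota 0 B.+1); rewrite mem_iota add0n ltnS.
  (* An entry with [i] and [j] both equal to [i1] is bounded through [r], every other one through
     [q]. *)
  have [/andP[/eqP ii /eqP jj]|ij] := boolP ((i == i1) && (j == i1)).
    have l1 : l != i1 by apply: contra x1 => /eqP ->; rewrite ii jj.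
    apply: leq_trans (Arr_le_r _ AA _) _; first by rewrite negb_and l1 orbT.
    by apply: leq_trans (qrB j l _ _); rewrite ?leq_addl.
  apply: leq_trans (Arr_le_q _ AA ij) _.
  by apply: leq_trans (qrB i j _ _); rewrite ?leq_addr.
move=> A A'; rewrite !inE => -[s AA] [s' AA'] /eq_in_map E.
have eqA i j l : (i, j, l) != (i1, i1, i1) -> A i j l = A' i j l.
  move=> ijl1; have ijl1' : ~~ [&& i == i1, j == i1 & l == i1].
    by apply: contra ijl1 => /and3P[/eqP -> /eqP -> /eqP ->].
  have [ijl|ijl] := boolP [&& i \in js, j \in js & l \in js]; last first.
    have [/eqP ->|/(Arr_supp i1js qjs rjs AA)] := boolP (A i j l == 0);
      last by rewrite (negPf ijl).
    have [/eqP ->//|/(Arr_supp i1js qjs rjs AA')] := boolP (A' i j l == 0);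
      by rewrite (negPf ijl).
  rewrite -(natvalK k0 (Arr_in_nat AA ijl1')) -(natvalK k0 (Arr_in_nat AA' ijl1')).
  congr _%:R; apply: (E (i, j, l)); rewrite mem_filter ijl1 /=.
  by case/and3P: ijl => ijs jjs ljs; rewrite allpairs_f// allpairs_f.
apply/funext => i; apply/funext => j; apply: funext.
have [/andP[/eqP -> /eqP ->]|ij] := boolP ((i == i1) && (j == i1)).
  (* The corner entry is missing from the code; it is recovered from the sum [q i1 i1]. *)
  apply: (@eq_total _ _ i1); [exact: Arr_finite3 AA | exact: Arr_finite3 AA' | |].
    by move=> l l1; apply: eqA; rewrite !xpair_eqE !eqxx.
  by have [_ _ -> _ _] := AA; have [_ _ -> _ _] := AA'.
by move=> l; apply: eqA; rewrite !xpair_eqE negb_and ij.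
Qed.

End Arrays.

(** * The coefficient of an array as a finite product *)

Section VList.
Variables (q r s : I -> I -> k) (js : seq I).
Hypotheses (ujs : uniq js) (i1js : i1 \in js)
  (qjs : forall i j, q i j != 0 -> (i \in js) && (j \in js))
  (rjs : forall j l, r j l != 0 -> (j \in js) && (l \in js)).
Variable A : I -> I -> I -> k.
Hypothesis AA : Arr t q r s A.

(** The length of the falling factorial in the factor (1, 1) of [V_ A]. *)
Definition corner_shift : nat := \sum_(j <- js | j != i1) natval (A i1 j i1).

Lemma Arr_in_nat1 j : j != i1 -> in_nat (A i1 j i1).
Proof. by move=> j1; apply: Arr_in_nat AA _; rewrite (negPf j1) andbF. Qed.

Lemma natval_fact1 i j l : ~~ [&& i \in js, j \in js & l \in js] ->
  (natval (A i j l))`!%:R = 1 :> k.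
Proof.
move=> ijl; suff -> : A i j l = 0 by rewrite natval0.
by apply: contraNeq ijl => /(Arr_supp i1js qjs rjs AA).
Qed.

Lemma Vfactor_corner : Vfactor A i1 i1 =
  (\prod_(m < corner_shift) (s i1 i1 - m%:R)) /
  (\prod_(j <- js | j != i1) (natval (A i1 j i1))`!%:R).
Proof.
have js2 (j : I) : (j \in [set j : I | (2 <= j)%N]) = (j != i1).
  by rewrite neq_i1; apply/idP/idP; rewrite inE.
pose js' := [seq j <- js | j != i1].
have ujs' : uniq js' by rewrite filter_uniq.
have js'2 : [set` js'] `<=` [set j : I | (2 <= j)%N].
  by move=> j /=; rewrite mem_filter neq_i1 => /andP[].
have js'N j : [set j : I | (2 <= j)%N] j -> j \notin js' -> j \notin js.
  by move=> /= j2; rewrite mem_filter neq_i1 j2.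
rewrite /Vfactor i1E eqxx /=; congr (_ / _).
  have [_ _ _ _ ->] := AA.
  suff -> : natval (\sum_(j \in [set j : I | (2 <= j)%N]) A i1 j i1) = corner_shift by [].
  rewrite (fsbigE js')//; last first.
    move=> j j2 /(js'N _ j2) jN; apply: contraNeq jN.
    by move=> /(Arr_supp i1js qjs rjs AA)/and3P[].
  rewrite (eq_bigl _ _ js2) big_filter_cond /=.
  rewrite -[RHS](natval_nat k0) natr_sum; congr natval.
  rewrite (eq_bigl (fun j => j != i1)) => [|j]; last by rewrite andbb.
  by apply: eq_bigr => j j1; rewrite natvalK//; exact: Arr_in_nat1.
rewrite (fsbigE js')//; last first.
  by move=> j j2 /(js'N _ j2) jN; apply: natval_fact1; rewrite (negPf jN) andbF.
rewrite (eq_bigl _ _ js2) big_filter_cond /=.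
by apply: eq_bigl => j; rewrite andbb.
Qed.

Lemma Vfactor_noncorner i l : (i, l) != (i1, i1) -> Vfactor A i l =
  (natval (s i l))`!%:R / (\prod_(j <- js) (natval (A i j l))`!%:R).
Proof.
move=> il; rewrite /Vfactor eq_i1_pair (negPf il); have [_ _ _ _ ->] := AA.
congr (_ / _); rewrite (fsbigE js)//.
  by apply: eq_bigl => j; rewrite in_setT.
by move=> j _ jN; apply: natval_fact1; rewrite (negPf jN) andbF.
Qed.

(** In a cell outside [js] both [s] and the entries of [A] vanish, so its factor is 1. *)
Lemma V_list : V_ A =
  \prod_(p <- [seq (i, l) | i <- js, l <- js]) Vfactor A p.1 p.2.
Proof.
rewrite /V_ (fsbigE [seq (i, l) | i <- js, l <- js])//.
- by apply: eq_bigl => p; rewrite in_setT.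
- by apply: allpairs_uniq => // -[? ?] [? ?].
move=> [i l] _ /= il.
have iljs : ~~ ((i \in js) && (l \in js)).
  by apply: contra il => /andP[ijs ljs]; rewrite allpairs_f.
have il1 : (i, l) != (i1, i1).
  by apply: contra iljs => /eqP[-> ->]; rewrite i1js.
rewrite Vfactor_noncorner// big1 => [|j _]; last first.
  by apply: natval_fact1; apply: contra iljs => /and3P[-> _ ->].
have -> : s i l = 0.
  by apply: contraNeq iljs => /(Arr_supp_s i1js qjs rjs ujs AA).
by rewrite natval0 divr1.
Qed.

Lemma Arr_corner : s i1 i1 = A i1 i1 i1 + corner_shift%:R.
Proof.
rewrite (Arr_sum_s i1js qjs rjs ujs i1 i1 AA) (bigD1_seq i1)//=; congr (_ + _).
rewrite natr_sum; apply: eq_bigr => j j1; rewrite natvalK//.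
exact: Arr_in_nat1.
Qed.

End VList.

(** * Counting polynomials, integrals of indicators and fixed points *)

Section Counting.
Variable X : finitary.

Lemma counting_polyE (L : set X) P : is_counting_poly L P -> counting_poly L = P.
Proof.
move=> LP; apply: xget_unique => // Q [N' QP']; have [N PP'] := LP.
apply/eqP; rewrite -subr_eq0; apply/eqP; set R := Q - P.
(* Both polynomials count the same sets at these arguments, so a nonzero difference [R] would have
   [size R] distinct roots, too many for its degree. *)
pose rs : seq rat := [seq p%:R | p <- iota (maxn N N') (size R)].
have uR : uniq rs.
  by rewrite map_inj_uniq ?iota_uniq// => p p' /eqP; rewrite Num.Theory.eqr_nat => /eqP.
apply: contraTeq (leqnn (size rs)) => R0; rewrite -ltnNge.
have sz : size rs = size R by rewrite size_map size_iota.
rewrite {2}sz; apply: max_poly_roots => //.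
apply/allP => _ /mapP[p + ->]; rewrite mem_iota geq_max => /andP[/andP[Np Np'] _].
have [m Lm Pm] := PP' p Np; have [m' Lm' Qm] := QP' p Np'.
rewrite /root !hornerE Pm Qm.
suff -> : m = m' by rewrite subrr.
by apply/card_eq_II; apply: card_eq_trans Lm'; rewrite card_eq_sym.
Qed.

Lemma mu_counting (L : set X) P : is_counting_poly L P ->
  mu t L = (map_poly ratr P).[t].
Proof. by rewrite /mu => /counting_polyE ->. Qed.

Lemma mu_set0 : mu t (set0 : set X) = 0.
Proof.
rewrite (@mu_counting _ 0) ?map_poly0 ?horner0//.
exists 0%N => p _; exists 0%N; last by rewrite horner0.
rewrite (_ : fixpts _ _ = set0) ?II0 ?card_eq00//.
by apply/seteqP; split=> x // -[].
Qed.

(** The value 0 contributes nothing. If [L] is empty, the value 1 is not taken, but then the measure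
    is 0 too. *)
Lemma integral_indicator (L : set X) :
  integral t (fun x => (`[< L x >])%:R : k) = mu t L.
Proof.
rewrite /integral; set f := fun x => _.
have f1 : f @^-1` [set 1] = L.
  apply/seteqP; split=> x; rewrite /f /=; case: asboolP => //.
  by move=> _ /eqP; rewrite eq_sym oner_eq0.
have [[x Lx]|nL] := pselect (exists x, L x).
  rewrite -(@fsbig_widen _ _ _ _ [set 1]); first by rewrite fsbig_set1 mul1r f1.
    by move=> _ ->; exists x => //; rewrite /f asboolT.
  move=> _ [[y _ <-] /=]; rewrite /f; case: asboolP => //= _ _; exact: mul0r.
have -> : L = set0 by apply/seteqP; split=> x // Lx; case: nL; exists x.
rewrite mu_set0; apply: fsbig1 => _ [y _ <-].
by rewrite /f asboolF ?mul0r// => Ly; apply: nL; exists y.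
Qed.

End Counting.

(** A point [w > p] of another color than [i1] could be exchanged with a distant point of color [i1]
    by an element of [frakS p], changing the coloring. *)
Lemma fixed_frakS (b : Lam n t) (z : X_ b) p :
  (forall g, frakS p g -> act g z = z) <-> bounded_col i1 p (pt_col z).
Proof.
split=> [zS w wp|zp g gp].
  apply/eqP/negP => /negP z1; have [M zM _] := pt_col_profile z.
  pose w' := om (maxn w M).
  have zw' : pt_col z w' = i1 by apply: zM; rewrite /= ltnS leq_maxr.
  have ww' : (w < w')%N by rewrite /= ltnS leq_maxl.
  have gS : frakS p (transp w w').
    move=> u /= up; rewrite /= /tperm_fun.
    by rewrite !ifN//; apply/eqP => E; move: up; rewrite leqNgt E ?(ltn_trans wp ww') ?wp.
  move/negP: z1; apply; rewrite -(zS _ gS) pt_col_act /= /tperm_fun eqxx.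
  exact/eqP.
apply: pt_col_inj => w; rewrite pt_col_act; have [wp|wp] := leqP w p.
  by congr pt_col; rewrite -{1}(gp w wp) -permEM mulVg.
rewrite !zp// ltnNge; apply/negP => gw.
have E : (g^-1)%g w = w by rewrite -[LHS](gp _ gw) -permEM mulgV.
by rewrite E leqNgt wp in gw.
Qed.

(** * The measure of the set of intermediate points *)

Section CountPoints.
Variables (b c d : Lam n t) (q r s : I -> I -> k) (y0 : X_ d) (x0 : X_ b).
Hypotheses (qM : Mat t (val d) (val c) q) (rM : Mat t (val c) (val b) r)
  (y0x0s : has_position y0 x0 s).
Variable js : seq I.
Hypotheses (ujs : uniq js) (i1js : i1 \in js)
  (qjs : forall i j, q i j != 0 -> (i \in js) && (j \in js))
  (rjs : forall j l, r j l != 0 -> (j \in js) && (l \in js))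
  (sjs : forall i l, s i l != 0 -> (i \in js) && (l \in js)).

Let pairs := [seq (i, l) | i <- js, l <- js].
Let D p := colseq p (pair_col y0 x0).

Let uniq_pairs : uniq pairs.
Proof. by apply: allpairs_uniq => // -[? ?] [? ?]. Qed.

Let corner_pairs : (i1, i1) \in pairs.
Proof. by rewrite allpairs_f. Qed.

Definition between (z : X_ c) := has_position y0 z q /\ has_position z x0 r.

(** The fixed pair (y, x) comes first and the varying middle color last, so arrays are read below in
    the index order i, l, j. *)
Definition trip (cz : Omega -> I) (w : Omega) : I * I * I := (pair_col y0 x0 w, cz w).

Let corner : I * I * I := (i1, i1, i1).

Lemma trip_il cz A : profile t corner (trip cz) A ->
  profile t (i1, i1) (pair_col y0 x0) (fun p => \sum_(j \in [set: I]) A (p, j)).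
Proof.
by apply: (@profile_marginal _ _ _ _ _ corner fst snd (fun j p => (p, j))) => // -[].
Qed.

Lemma trip_ij cz A : profile t corner (trip cz) A ->
  profile t (i1, i1) (fun w => (pt_col y0 w, cz w))
    (fun p => \sum_(l \in [set: I]) A (p.1, l, p.2)).
Proof.
apply: (@profile_marginal _ _ _ _ _ corner (fun x => (x.1.1, x.2))
  (fun x => x.1.2) (fun l p => (p.1, l, p.2))) => //; [by move=> ? []|by move=> [[]]].
Qed.

Lemma trip_jl cz A : profile t corner (trip cz) A ->
  profile t (i1, i1) (fun w => (cz w, pt_col x0 w))
    (fun p => \sum_(i \in [set: I]) A (i, p.2, p.1)).
Proof.
apply: (@profile_marginal _ _ _ _ _ corner (fun x => (x.2, x.1.2))
  (fun x => x.1.1) (fun i p => (i, p.2, p.1))) => //; [by move=> ? []|by move=> [[]]].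
Qed.

(** Summing the triple profile over one index gives the profile of the pair formed by the other two
    points. *)
Lemma Arr_of_trip z A : between z ->
    profile t corner (trip (pt_col z)) (fun x => A x.1.1 x.2 x.1.2) ->
  Arr t q r s A.
Proof.
move=> [y0zq zx0r] zA; split.
- move=> i j l; rewrite !eq_i1; case: ifPn => [/and3P[/eqP -> /eqP -> /eqP ->]|ijl].
    exact: (profile_in_tZ zA).
  apply: (profile_in_nat (x := (i, l, j)) zA).
  by apply: contra ijl => /eqP[-> -> ->]; rewrite !eqxx.
- apply: sub_finite_set (finite_image (fun x => (x.1.1, x.2, x.1.2)) (profile_finite zA)).
  by move=> [[i j] l] /= Aijl; exists (i, l, j).
- by move=> i j; apply: (profile_uniq (trip_ij zA) y0zq (i, j)).
- by move=> j l; apply: (profile_uniq (trip_jl zA) zx0r (j, l)).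
- by move=> i l; apply: (profile_uniq (trip_il zA) y0x0s (i, l)).
Qed.

(** The marginal [q] has column sums [val c], so [cz] is the coloring of a point of [X_ c]. *)
Lemma trip_of_Arr cz A : Arr t q r s A ->
    profile t corner (trip cz) (fun x => A x.1.1 x.2 x.1.2) ->
  exists2 z, between z & pt_col z =1 cz.
Proof.
move=> [_ _ Aq Ar _] zA.
have zq : profile t (i1, i1) (fun w => (pt_col y0 w, cz w)) (fun p => q p.1 p.2).
  by have := trip_ij zA; congr profile; apply/funext => p; rewrite -Aq.
have zr : profile t (i1, i1) (fun w => (cz w, pt_col x0 w)) (fun p => r p.1 p.2).
  by have := trip_jl zA; congr profile; apply/funext => p; rewrite -Ar.
have [z zE] : exists z : X_ c, pt_col z =1 cz.
  apply: pt_col_surj; have [_ _ _ qc _] := qM.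
  by have := profile_snd zq; congr profile; apply/funext.
exists z => //; split.
  by apply: profile_ext zq => w; rewrite /pair_col zE.
by apply: profile_ext zr => w; rewrite /pair_col zE.
Qed.

Variables (p0 N0 : nat).
Hypotheses (p0D : bounded_col (i1, i1) p0 (pair_col y0 x0)) (sN0 : s i1 i1 = t - N0%:R).

(* The number of w <= p with cell and color [x] when the triple coloring has
   profile [A]; only the corner depends on p, as [N0 + corner_shift js A] is the
   number of points away from the corner. *)
Definition joint (p : nat) (A : I -> I -> I -> k) (x : I * I * I) : nat :=
  if x == corner then (p - (N0 + corner_shift js A))%N else natval (A x.1.1 x.2 x.1.2).

Section OneLevel.
Variable p : nat.
Hypothesis p0p : (p0 <= p)%N.

Let pD : bounded_col (i1, i1) p (pair_col y0 x0) := bounded_col_le p0p p0D.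

Let size_D : size (D p) = p. Proof. exact: size_colseq. Qed.

Lemma pair_count i l : (count_mem (i, l) (D p))%:R +
  (if (i, l) == (i1, i1) then t - p%:R else 0) = s i l.
Proof. by rewrite -(profile_colseq pD y0x0s (i, l)) /vcount size_D. Qed.

(** Two expressions for [s i1 i1] are compared: [t - N0], and the number of points of the corner
    cell up to [p] plus [t - p]. *)
Lemma pair_count_corner : (count_mem (i1, i1) (D p) + N0)%N = p.
Proof.
have := pair_count i1 i1; rewrite eqxx sN0 addrCA => /addrI E.
apply: (natr_inj_char0 k0); apply: (addIr (- p%:R)).
by rewrite natrD addrAC E addNr subrr.
Qed.

Lemma pair_count_noncorner i l : (i, l) != (i1, i1) ->
  count_mem (i, l) (D p) = natval (s i l).
Proof. by move=> /negPf il; rewrite -pair_count il addr0 natval_nat. Qed.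

Lemma mem_D x : x \in D p -> x \in pairs.
Proof.
case: x => i l ilD; have [->//|il] := eqVneq (i, l) (i1, i1).
have /sjs/andP[ijs ljs] : s i l != 0; last by rewrite allpairs_f.
rewrite -pair_count (negPf il) addr0; have /pcharf0P -> := k0.
by rewrite -lt0n -has_count has_pred1.
Qed.

Variable A : I -> I -> I -> k.
Hypotheses (AA : Arr t q r s A) (pA : (N0 + corner_shift js A <= p)%N).

(** At the corner, [p - N0 - corner_shift js A] plus [t - p] is [s i1 i1 - corner_shift js A], the
    corner entry of [A]. *)
Lemma jointE i l j : (joint p A (i, l, j))%:R +
  (if (i, l, j) == corner then t - p%:R else 0) = A i j l.
Proof.
rewrite /joint /=; case: eqP => [[-> -> ->]|/eqP ijl]; last first.
  rewrite addr0 natvalK//; apply: Arr_in_nat AA _.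
  by apply: contra ijl => /and3P[/eqP -> /eqP -> /eqP ->].
have := Arr_corner ujs i1js qjs rjs AA; rewrite sN0 => E.
rewrite natrB// natrD; apply: (addIr (corner_shift js A)%:R).
by rewrite -E; ring.
Qed.

Lemma has_countsP (u : seq I) : size u = p ->
  has_counts (D p) (joint p A) u <->
  vcount t corner (zip (D p) u) =1 (fun x => A x.1.1 x.2 x.1.2).
Proof.
move=> su; have sz : size (zip (D p) u) = p by rewrite size_zip size_D su minnn.
rewrite /vcount sz; split=> [/asboolP E [[i l] j]|E].
  by rewrite E -jointE.
apply/asboolP => -[[i l] j]; apply: (natr_inj_char0 k0).
by have := E (i, l, j); rewrite /= -jointE => /addIr.
Qed.

Lemma joint_out x j : j \notin js -> joint p A (x, j) = 0%N.
Proof.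
case: x => i l jN; rewrite /joint ifN; last first.
  by apply: contra jN => /eqP[_ _ ->].
suff -> : A i j l = 0 by rewrite natval0.
by apply: contraNeq jN => /(Arr_supp i1js qjs rjs AA)/and3P[].
Qed.

Lemma joint_sum x : (\sum_(j <- js) joint p A (x, j))%N = count_mem x (D p).
Proof.
case: x => i l; apply: (natr_inj_char0 k0).
apply: (addIr (if (i, l) == (i1, i1) then t - p%:R else 0)).
rewrite pair_count (Arr_sum_s i1js qjs rjs ujs i l AA).
under [RHS]eq_bigr do rewrite -jointE.
rewrite big_split natr_sum /=; congr (_ + _).
rewrite (bigD1_seq i1)//= big1 => [|j /negPf j1].
  by rewrite addr0 [_ == corner]xpair_eqE eqxx andbT.
by rewrite [_ == corner]xpair_eqE j1 andbF.
Qed.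

End OneLevel.

Definition noncorner_mult (F : fieldType) (A : I -> I -> I -> k) : F :=
  (\prod_(x <- pairs | x != (i1, i1)) (natval (s x.1 x.2))`!%:R) /
  (\prod_(x <- pairs | x != (i1, i1)) \prod_(j <- js) (natval (A x.1 j x.2))`!%:R) /
  (\prod_(j <- js | j != i1) (natval (A i1 j i1))`!%:R).

(* The product stands for the quotient (p - N0)! / (p - N0 - corner_shift js A)!. *)
Definition Apoly (A : I -> I -> I -> k) : {poly rat} :=
  (noncorner_mult rat A)%:P *
  \prod_(m < corner_shift js A) ('X - (N0 + m)%:R%:P).

(** At [t] the factor [t - (N0 + m)] becomes [s i1 i1 - m], a factor of the falling factorial in
    [V_ A]. *)
Lemma Apoly_eval A : Arr t q r s A -> (map_poly ratr (Apoly A)).[t] = V_ A.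
Proof.
move=> AA; rewrite (V_list ujs i1js qjs rjs AA) (bigD1_seq _ corner_pairs)//=.
rewrite (Vfactor_corner ujs i1js qjs rjs AA) -[map_poly _ _]/(map_poly (char0_ratr k0) _).
rewrite rmorphM /= map_polyC /= rmorph_prod hornerM hornerC horner_prod.
have -> : char0_ratr k0 (noncorner_mult rat A) = noncorner_mult k A.
  rewrite /noncorner_mult !fmorph_div /= !rmorph_prod.
  congr (_ / _ / _); apply: eq_bigr => x _; rewrite ?rmorph_nat// rmorph_prod.
  by apply: eq_bigr => j _; rewrite rmorph_nat.
have -> : \prod_(x <- pairs | x != (i1, i1)) Vfactor A x.1 x.2 =
    (\prod_(x <- pairs | x != (i1, i1)) (natval (s x.1 x.2))`!%:R) /
    (\prod_(x <- pairs | x != (i1, i1)) \prod_(j <- js) (natval (A x.1 j x.2))`!%:R).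
  rewrite -prodf_div; apply: eq_bigr => -[i l] il.
  by rewrite (Vfactor_noncorner ujs i1js qjs rjs AA).
rewrite /noncorner_mult [RHS]mulrC [RHS]mulrA mulrAC; congr (_ * _ * _).
apply: eq_bigr => m _.
by rewrite rmorphB /= map_polyX map_polyC /= rmorph_nat !hornerE sN0 natrD opprD addrA.
Qed.

(** The words are counted by [count_words]. The corner cell has [a = p - N0] points, and the product
    in [Apoly] evaluates to the falling factorial of [a]. *)
Lemma Apoly_nat A p : Arr t q r s A -> (p0 <= p)%N -> (N0 + corner_shift js A <= p)%N ->
  (Apoly A).[p%:R] = (count (has_counts (D p) (joint p A)) (words js p))%:R.
Proof.
move=> AA p0p pA.
have := @count_words _ _ pairs js uniq_pairs ujs (D p) (joint p A) (@mem_D p p0p)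
  (fun x => @joint_out p A AA x) (joint_sum p0p AA pA).
rewrite size_colseq; set m := count _ _ => /(congr1 (fun x : nat => x%:R : rat)).
rewrite !(bigD1_seq _ corner_pairs)//= (bigD1_seq _ i1js)//=.
set a := count_mem (i1, i1) (D p).
have aN0 : (a + N0)%N = p by exact: pair_count_corner.
have ba : (corner_shift js A <= a)%N by rewrite -(leq_add2l N0) (addnC N0 a) aN0.
have -> : joint p A (i1, i1, i1) = (a - corner_shift js A)%N.
  by rewrite /joint eqxx -aN0 addnC subnDl.
(* Splitting [a] factorial isolates the factorial of the corner entry of [joint], which also stands
   on the other side and cancels. *)
rewrite -(ffact_fact ba) !natrM !natr_prod.
have f0 (l : nat) : (l`!%:R : rat) != 0 by rewrite Num.Theory.pnatr_eq0 -lt0n fact_gt0.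
have -> : \prod_(j <- js | j != i1) (joint p A (i1, i1, j))`!%:R =
    \prod_(j <- js | j != i1) (natval (A i1 j i1))`!%:R :> rat.
  by apply: eq_bigr => j /negPf j1; rewrite /joint [_ == corner]xpair_eqE j1 andbF.
have -> : \prod_(x <- pairs | x != (i1, i1)) (count_mem x (D p))`!%:R =
    \prod_(x <- pairs | x != (i1, i1)) (natval (s x.1 x.2))`!%:R :> rat.
  by apply: eq_bigr => -[i l] il; rewrite pair_count_noncorner.
have -> : \prod_(x <- pairs | x != (i1, i1)) (\prod_(j <- js) (joint p A (x, j))`!)%:R =
    \prod_(x <- pairs | x != (i1, i1)) \prod_(j <- js) (natval (A x.1 j x.2))`!%:R :> rat.
  apply: eq_bigr => x /negPf x1; rewrite natr_prod; apply: eq_bigr => j _.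
  by rewrite /joint [_ == corner]xpair_eqE x1.
rewrite /Apoly /noncorner_mult hornerM hornerC horner_prod.
have -> : \prod_(m < corner_shift js A) ('X - (N0 + m)%:R%:P).[p%:R] =
    (a ^_ corner_shift js A)%:R :> rat.
  rewrite ffact_prod natr_prod; apply: eq_bigr => i _.
  rewrite !hornerE -aN0 natrB; last by rewrite (leq_trans (ltnW (ltn_ord i)) ba).
  by rewrite !natrD; ring.
set G := \prod_(j <- _ | _) _; set E := \prod_(x <- _ | _) _.
set F := \prod_(x <- _ | _) _; set ff := (_ ^_ _)%:R.
have E0 : E != 0.
  by rewrite prodf_seq_neq0; apply/allP => x _; apply/implyP => _; rewrite prodf_seq_neq0;
    apply/allP => j _; apply/implyP.
have G0 : G != 0 by rewrite prodf_seq_neq0; apply/allP => j _; apply/implyP.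
move=> mE; apply: (mulIf (mulf_neq0 (mulf_neq0 (f0 (a - corner_shift js A)%N) G0) E0)).
by rewrite mE; field; rewrite E0 G0.
Qed.

Lemma zip_colseq (T T' : Type) p (f : Omega -> T) (g : Omega -> T') :
  zip (mkseq (f \o om) p) (mkseq (g \o om) p) = mkseq ((fun w => (f w, g w)) \o om) p.
Proof. by rewrite /mkseq; elim: (iota _ _) => //= i l ->. Qed.

(** A letter other than [i1] at a point forces a nonzero entry of [q], so it lies in [js]; the array
    is the profile of the triple coloring. *)
Lemma between_colseq z p : (p0 <= p)%N -> between z -> bounded_col i1 p (pt_col z) ->
  colseq p (pt_col z) \in words js p /\
  exists2 A, Arr t q r s A &
    vcount t corner (zip (D p) (colseq p (pt_col z))) =1 (fun x => A x.1.1 x.2 x.1.2).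
Proof.
move=> p0p zL zp; have [y0zq _] := zL.
have y0x0p := bounded_col_le p0p p0D.
have tripp : bounded_col corner p (trip (pt_col z)).
  by move=> w wp; rewrite /trip y0x0p ?zp.
split.
  rewrite mem_words size_colseq eqxx; apply/allP => _ /mapP[i ip ->] /=.
  have [->//|j1] := eqVneq (pt_col z (om i)) i1.
  suff /qjs/andP[] : q (pt_col y0 (om i)) (pt_col z (om i)) != 0 by [].
  have y0zp : bounded_col (i1, i1) p (pair_col y0 z).
    move=> w wp; rewrite /pair_col zp//; congr (_, _).
    by have := y0x0p w wp => -[].
  have /= <- := profile_colseq y0zp y0zq (pt_col y0 (om i), pt_col z (om i)).
  rewrite /vcount ifN ?addr0; last by apply: contra j1 => /eqP[_ ->].
  have /pcharf0P -> := k0; rewrite -lt0n -has_count has_pred1.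
  by apply/mapP; exists i.
pose A i j l := vcount t corner (zip (D p) (colseq p (pt_col z))) (i, l, j).
have zA : profile t corner (trip (pt_col z)) (fun x => A x.1.1 x.2 x.1.2).
  by exists p => // -[[i l] j]; rewrite /A /D /colseq zip_colseq.
by exists A; [exact: Arr_of_trip zL zA | move=> [[i l] j]].
Qed.

(** The word is continued by [i1] beyond [p], and [trip_of_Arr] turns the resulting coloring into a
    point. *)
Lemma colseq_between u p A : (p0 <= p)%N -> size u = p -> Arr t q r s A ->
    vcount t corner (zip (D p) u) =1 (fun x => A x.1.1 x.2 x.1.2) ->
  exists2 z, between z /\ bounded_col i1 p (pt_col z) & colseq p (pt_col z) = u.
Proof.
move=> p0p su AA uA; pose cz (w : Omega) := nth i1 u (w : nat).-1.
have czp : bounded_col i1 p cz.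
  by move=> w wp; rewrite /cz nth_default// su -ltnS prednK// idx_gt0.
have czu : colseq p cz = u by rewrite /colseq -su -[RHS](mkseq_nth i1).
have y0x0p := bounded_col_le p0p p0D.
have zA : profile t corner (trip cz) (fun x => A x.1.1 x.2 x.1.2).
  exists p; first by move=> w wp; rewrite /trip y0x0p ?czp.
  by rewrite -czu /D /colseq zip_colseq in uA.
have [z zL zE] := trip_of_Arr AA zA.
exists z; first by split=> // w wp; rewrite zE czp.
by rewrite -czu /colseq; apply: eq_mkseq => i /=; rewrite zE.
Qed.

Lemma mu_between : mu t between = \sum_(A \in Arr t q r s) V_ A.
Proof.
have [_ qfin _ _ _] := qM; have [_ rfin _ _ _] := rM.
have Afin : finite_set (Arr t q r s).
  by apply: sub_finite_set (finite_Arr qfin rfin) => A AA; exists s.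
have [L uL LE] : exists2 L, uniq L & Arr t q r s = [set` L].
  have /finite_seqP[L LE] := Afin; exists (undup L); first exact: undup_uniq.
  by rewrite LE; apply/seteqP; split=> A /=; rewrite mem_undup.
have LA A : A \in L -> Arr t q r s A by rewrite LE.
rewrite LE -fsbig_seq//.
rewrite (@mu_counting _ _ (\sum_(A <- L) Apoly A)); last first.
  (* Beyond this threshold the pair coloring is constant and the truncated subtraction in [joint] is
     exact for every array. *)
  exists (maxn p0 (\max_(A <- L) (N0 + corner_shift js A)))%N => p.
  rewrite geq_max => /andP[p0p pL].
  have pA A : A \in L -> (N0 + corner_shift js A <= p)%N.
    by move=> AL; apply: leq_trans pL; exact: leq_bigmax_seq.
  pose Q u := has (fun A => has_counts (D p) (joint p A) u) L.
  exists (size [seq u <- words js p | Q u]).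
    have cS : {in fixpts between (frakS p) &, injective (fun z => colseq p (pt_col z))}.
      move=> z z'; rewrite !inE => -[_ /fixed_frakS zp] [_ /fixed_frakS z'p] E.
      by apply: pt_col_inj => w; rewrite -(nth_colseq w zp) E nth_colseq.
    have := inj_card_eq cS; rewrite card_eq_sym => /card_eq_trans; apply.
    rewrite (_ : _ @` _ = [set` [seq u <- words js p | Q u]]); last first.
      apply/seteqP; split=> [_ [z [zL /fixed_frakS zp] <-]|u] /=.
        have [zw [A AA zA]] := between_colseq p0p zL zp.
        rewrite mem_filter zw andbT; have AL : A \in L by move: AA; rewrite LE.
        by apply/hasP; exists A => //; apply/has_countsP => //; rewrite ?pA ?size_colseq.
      rewrite mem_filter mem_words => /andP[/hasP[A AL uA] /andP[/eqP su _]].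
      move/(has_countsP (LA A AL) (pA A AL) su) in uA.
      have [z [zL zp] zu] := colseq_between p0p su (LA A AL) uA.
      by exists z => //; split=> //; apply/fixed_frakS.
    by apply: card_set_seq; rewrite filter_uniq// words_uniq.
  rewrite horner_sum big_seq.
  under eq_bigr => A AL do rewrite (Apoly_nat (LA A AL) p0p (pA A AL)).
  rewrite -big_seq -natr_sum; congr _%:R; rewrite size_filter.
  under eq_bigr do rewrite -sum1_count big_mkcond.
  rewrite exchange_big /= -sum1_count [RHS]big_mkcond /= !big_seq.
  apply: eq_bigr => u; rewrite mem_words => /andP[/eqP su _].
  rewrite /Q; case: ifPn => [/hasP[A AL uA]|/hasPn uN]; last first.
    by rewrite big_seq big1// => A /uN /negPf ->.
  (* A word determines its triple profile, so it is counted for exactly one array. *)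
  rewrite (bigD1_seq A)//= uA big_seq_cond big1// => A' /andP[A'L A'A].
  case: ifPn => // uA'; case/eqP: A'A.
  apply/funext => i; apply/funext => j; apply/funext => l.
  move/(has_countsP (LA A AL) (pA A AL) su): uA => /(_ (i, l, j)) /= <-.
  by move/(has_countsP (LA A' A'L) (pA A' A'L) su): uA' => /(_ (i, l, j)).
rewrite -[map_poly _ _]/(map_poly (char0_ratr k0) _) rmorph_sum horner_sum.
by rewrite !big_seq; apply: eq_bigr => A /LA/Apoly_eval.
Qed.

End CountPoints.

(** * The coefficients of the product *)

Section Product.

Lemma finite_common_support (ms : seq (I -> I -> k)) :
    (forall m, m \in ms -> finite_set [set p : I * I | m p.1 p.2 != 0]) ->
  exists js : seq I, [/\ uniq js, i1 \in js &
    forall m, m \in ms -> forall i j, m i j != 0 -> (i \in js) && (j \in js)].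
Proof.
elim: ms => [|m ms IHms] mfin; first by exists [:: i1]; split; rewrite ?inE.
have [|js [ujs i1js jsP]] := IHms.
  by move=> m' m'ms; apply: mfin; rewrite inE m'ms orbT.
have /finite_seqP[l lE] := mfin m (mem_head _ _).
exists (undup (js ++ map fst l ++ map snd l)); split; first exact: undup_uniq.
  by rewrite mem_undup mem_cat i1js.
move=> m' /[!inE] /orP[/eqP -> i j mij|m'ms i j m'ij].
  have ijl : (i, j) \in l by have : [set p | m p.1 p.2 != 0] (i, j) by []; rewrite lE.
  by rewrite !mem_undup !mem_cat (map_f fst ijl) (map_f snd ijl) !orbT.
by have /andP[ijs jjs] := jsP m' m'ms i j m'ij; rewrite !mem_undup !mem_cat ijs jjs.
Qed.

Variables (q r : Matn n t) (b d : Lam n t).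

(** Double sums of [A], taken in either order, identify the outer weights of [q] and [r] with [d]
    and [b] and their inner weights with each other. Hence there is no array unless the product
    passes through some [c]. *)
Lemma Arr_middle (s : I -> I -> k) A : Mat t (val d) (val b) s ->
    Arr t (val q) (val r) s A ->
  exists c : Lam n t, Mat t (val d) (val c) (val q) /\ Mat t (val c) (val b) (val r).
Proof.
move=> sM AA.
have := valP q; rewrite inE => -[d' [c [_ cL qM]]].
have := valP r; rewrite inE => -[c' [b' [_ _ rM]]].
have [_ qfin _ qc qd'] := qM; have [_ rfin _ rb' rc'] := rM.
have [_ sfin _ sb sd] := sM.
have [|js [ujs i1js jsP]] := @finite_common_support [:: val q; val r; s].
  by move=> m; rewrite !inE => /or3P[] /eqP ->.
have qjs := jsP (val q) (mem_head _ _).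
have rjs : forall j l, val r j l != 0 -> (j \in js) && (l \in js).
  by apply: jsP; rewrite !inE eqxx orbT.
have sjs : forall i l, s i l != 0 -> (i \in js) && (l \in js).
  by apply: jsP; rewrite !inE eqxx !orbT.
have rowE (m : I -> I -> k) i : (forall i j, m i j != 0 -> (i \in js) && (j \in js)) ->
    \sum_(j \in [set: I]) m i j = \sum_(j <- js) m i j.
  by move=> mjs; apply: fsum_seq => // j; apply: contraNeq => /mjs/andP[].
have colE (m : I -> I -> k) j : (forall i j, m i j != 0 -> (i \in js) && (j \in js)) ->
    \sum_(i \in [set: I]) m i j = \sum_(i <- js) m i j.
  by move=> mjs; apply: fsum_seq => // i; apply: contraNeq => /mjs/andP[].
have dE : d' = val d.
  apply/funext => i; rewrite -qd' -sd !rowE//.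
  under eq_bigr do rewrite (Arr_sum_q i1js qjs rjs ujs _ _ AA).
  rewrite exchange_big; apply: eq_bigr => l _.
  by rewrite (Arr_sum_s i1js qjs rjs ujs _ _ AA).
have cE : c' = c.
  apply/funext => j; rewrite -rc' -qc rowE// colE//.
  under eq_bigr do rewrite (Arr_sum_r i1js qjs rjs ujs _ _ AA).
  rewrite exchange_big; apply: eq_bigr => i _.
  by rewrite (Arr_sum_q i1js qjs rjs ujs _ _ AA).
have bE : b' = val b.
  apply/funext => l; rewrite -rb' -sb !colE//.
  under eq_bigr do rewrite (Arr_sum_r i1js qjs rjs ujs _ _ AA).
  rewrite exchange_big; apply: eq_bigr => i _.
  by rewrite (Arr_sum_s i1js qjs rjs ujs _ _ AA).
rewrite dE in qM; rewrite cE bE in rM; rewrite -in_setE in cL.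
by exists (exist _ c cL).
Qed.

Lemma schur_mul_position (y : X_ d) (x : X_ b) (s : I -> I -> k) :
    has_position y x s ->
  schur_mul (xi q) (xi r) (b, d) (y, x) = \sum_(A \in Arr t (val q) (val r) s) V_ A.
Proof.
move=> yxs; have sM := Mat_of_position yxs.
have -> : schur_mul (xi q) (xi r) (b, d) =
    \sum_(c \in [set: Lam n t]) hom_comp t (hom_at (xi q) c d) (hom_at (xi r) b c) by [].
have xi0 (m : Matn n t) b' d' : ~ Mat t (val d') (val b') (val m) ->
    hom_at (xi m) b' d' = 0.
  by move=> nM; rewrite /hom_at /= asboolF.
have [[c [qM rM]]|nc] := pselect (exists c : Lam n t,
    Mat t (val d) (val c) (val q) /\ Mat t (val c) (val b) (val r)); last first.
  rewrite !fsbig1 => [|A AA|c _]; first by [].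
    by case: nc; exact: Arr_middle AA.
  have [qM|nqM] := pselect (Mat t (val d) (val c) (val q)).
    by rewrite (xi0 r) ?hom_comp0r// => rM; apply: nc; exists c.
  by rewrite (xi0 q) ?hom_comp0l.
(* The weight [c] consists of the column sums of [q], so no other middle weight contributes. *)
rewrite (@fsum_set1 _ _ c) => [|c' c'c]; last first.
  rewrite (xi0 q) ?hom_comp0l// => -[_ _ _ qc' _]; case/eqP: c'c.
  by apply: val_inj; apply/funext => j; have [_ _ _ qc _] := qM; rewrite -qc' -qc.
have [_ qfin _ _ _] := qM; have [_ rfin _ _ _] := rM; have [_ sfin _ _ _] := sM.
have [|js [ujs i1js jsP]] := @finite_common_support [:: val q; val r; s].
  by move=> m; rewrite !inE => /or3P[] /eqP ->.
have qjs := jsP (val q) (mem_head _ _).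
have rjs : forall j l, val r j l != 0 -> (j \in js) && (l \in js).
  by apply: jsP; rewrite !inE eqxx orbT.
have sjs : forall i l, s i l != 0 -> (i \in js) && (l \in js).
  by apply: jsP; rewrite !inE eqxx !orbT.
have [p yxp] := position_bounded y x.
pose a := count_mem (i1, i1) (colseq p (pair_col y x)).
have ap : (a <= p)%N.
  by rewrite -[X in (_ <= X)%N](size_colseq p (pair_col y x)) count_size.
(* The role of [N0] is played by [p - a], the number of points up to [p] outside the corner cell. *)
have sN : s i1 i1 = t - (p - a)%:R.
  rewrite -(profile_colseq yxp yxs (i1, i1)) /vcount eqxx size_colseq natrB// -/a.
  by ring.
rewrite -(mu_between qM rM yxs ujs i1js qjs rjs sjs yxp sN) -integral_indicator /=.
(* The product of the two indicators is the indicator of [between]. *)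
congr integral; apply/funext => z.
transitivity (xi q (c, d) (y, z) * xi r (b, c) (z, x)); first by [].
by rewrite !xiE -natrM mulnb -asbool_and.
Qed.

End Product.

Lemma xi_coord_mul (q r s : Matn n t) : xi_coord (schur_mul (xi q) (xi r)) s =
  \sum_(A \in Arr t (val q) (val r) (val s)) V_ A.
Proof.
pose C (s : Matn n t) : k := \sum_(A \in Arr t (val q) (val r) (val s)) V_ A.
apply: (@xi_coord_unique _ C) => [|b d y x s' yxs']; last exact: schur_mul_position.
have := valP q; rewrite inE => -[_ [_ [_ _ [_ qfin _ _ _]]]].
have := valP r; rewrite inE => -[_ [_ [_ _ [_ rfin _ _ _]]]].
apply: (@finite_set_inj _ _ val); first by move=> ? ? _ _; exact: val_inj.
(* Each [s] with a nonzero coefficient has an array and is recovered from it by [S], so finiteness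
   of the set of arrays suffices. *)
pose S (A : I -> I -> I -> k) (i l : I) : k := \sum_(j \in [set: I]) A i j l.
apply: sub_finite_set (finite_image S (finite_Arr qfin rfin)) => _ [s' Cs' <-].
have [A AA _] := fsbigN1 (f := fun=> @V_ k n) (x := tt) Cs'.
exists A; first by exists (val s').
by apply/funext => i; apply/funext => l; have [_ _ _ _] := AA; apply.
Qed.

End SchurAlgebra.

Unset Implicit Arguments.
Local Close Scope ring_scope.
Local Close Scope card_scope.
Local Close Scope classical_set_scope.

Theorem theorem4p5p5 (k : fieldType) (chark : [pchar k]%R =i pred0) (t : k)
  (n : option nat) (hn : n <> Some 0) (q r s : Matn n t) :
  xi_coord (schur_mul (xi q) (xi r)) s =
  (\sum_(A \in Arr t (val q) (val r) (val s)) V_ A)%R.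
Proof.
(* The condition [n <> Some 0] provides the index 1, on which the corner is built. *)
have n1 : in_range n 1 by case: n hn {q r s} => [[]|].
exact: (@xi_coord_mul k t n (Idx n1) erefl chark).
Qed.
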